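(* Let $R$ be a ring and let $\varphi\in\mathrm{GA}_n(R)$. If $\varphi$ is locally tame, i.e., for every prime ideal $\mathfrak p\subset R$ the image $\varphi_{\mathfrak p}$ of $\varphi$ in $\mathrm{GA}_n(R_{\mathfrak p})$ lies in $\mathrm{TA}_n(R_{\mathfrak p})$, then $\varphi$ is stably tame.
   Context: ''Ring'' means commutative ring with identity. For a ring $R$, $\mathrm{GA}_n(R)$ is the group of polynomial automorphisms of affine $n$-space over $R$: its elements are vectors $\varphi=(F_1,\ldots,F_n)\in R[X_1,\ldots,X_n]^n$ which are invertible under composition (where $\varphi\circ\psi$ is obtained by substituting the components of $\psi$ for $X_1,\dots,X_n$ in $\varphi$), with identity $(X_1,\ldots,X_n)$. A ring homomorphism $R\to S$ induces a group homomorphism $\mathrm{GA}_n(R)\to\mathrm{GA}_n(S)$ by applying it to coefficients. An elementary automorphism is one of the form $e_i(f)=(X_1,\ldots,X_{i-1},X_i+f,X_{i+1},\ldots,X_n)$ with $f\in R[X_1,\ldots,X_{i-1},X_{i+1},\ldots,X_n]$; $\mathrm{EA}_n(R)$ is the subgroup generated by these. $\mathrm{GL}_n(R)\subseteq\mathrm{GA}_n(R)$ denotes the linear automorphisms. The tame subgroup $\mathrm{TA}_n(R)$ is the subgroup generated by $\mathrm{GL}_n(R)$ and $\mathrm{EA}_n(R)$. For $m\ge 0$, $\varphi^{[m]}=(F_1,\ldots,F_n,X_{n+1},\ldots,X_{n+m})\in\mathrm{GA}_{n+m}(R)$. $\varphi$ is stably tame if $\varphi^{[m]}\in\mathrm{TA}_{n+m}(R)$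 for some $m\ge0$. *)

(* Defs.v *)
From HB Require Import structures.
From mathcomp Require Import all_boot all_algebra ring boolp.
From mathcomp Require mpoly.

Set Implicit Arguments.
Unset Strict Implicit.
Unset Printing Implicit Defensive.

Import GRing.Theory.
Local Open Scope ring_scope.
Local Open Scope quotient_scope.

(** The localization of R at p is the quotient of the set of fractions a/s, with a in R
    and s outside p, by the relation
      a/s ~ b/t  iff  u (a t - b s) = 0 for some u outside p;
    the factor u is needed because R may have zero divisors.  The relation is
    turned into a boolean one with [asbool], that is, classically.
    MathComp's [prime_idealr R] is the type of prime ideals (proper by
    definition), given by boolean predicates; with [asbool] every prime ideal
    of R is of this form. *)

Module Localization.
Section Localization.

Variables (R : comNzRingType) (p : prime_idealr R).
Local Notation P := (p : pred R).

Definition frac := {x : R * R | x.2 \notin P}.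
Implicit Types x y z : frac.

Definition num x : R := (val x).1.
Definition den x : R := (val x).2.

Lemma denP x : den x \notin P. Proof. exact: (valP x). Qed.

Lemma notin1 : 1 \notin P. Proof. by rewrite idealr1. Qed.

Lemma notinM (s t : R) : s \notin P -> t \notin P -> s * t \notin P.
Proof. by move=> sP tP; rewrite prime_idealrM negb_or sP. Qed.

Definition mkfrac (a s : R) (sP : s \notin P) : frac :=
  @exist (R * R) (fun q => q.2 \notin P) (a, s) sP.

Definition equivf x y : bool :=
  `[< exists2 u : R, u \notin P & u * (num x * den y - num y * den x) = 0 >].

Lemma equivfP x y :
  reflect (exists2 u : R, u \notin P & u * (num x * den y - num y * den x) = 0)
          (equivf x y).
Proof. exact: asboolP. Qed.

Lemma equivf_refl : reflexive equivf.
Proof. by move=> x; apply/equivfP; exists 1; rewrite ?notin1 ?subrr ?mulr0. Qed.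

Lemma equivf_sym : symmetric equivf.
Proof.
suff imp x y : equivf x y -> equivf y x by move=> x y; apply/idP/idP; apply: imp.
case/equivfP=> u uP e; apply/equivfP; exists u => //.
by rewrite -opprB mulrN e oppr0.
Qed.

Lemma equivf_trans : transitive equivf.
Proof.
move=> y x z /equivfP[u uP e] /equivfP[v vP f]; apply/equivfP.
exists (u * v * den y); first by rewrite !notinM ?denP.
transitivity (v * den z * (u * (num x * den y - num y * den x))
   + u * den x * (v * (num y * den z - num z * den y))); first by ring.
by rewrite e f !mulr0 addr0.
Qed.

Canonical equivf_equiv := EquivRel equivf equivf_refl equivf_sym equivf_trans.

Definition type := {eq_quot equivf}.

HB.instance Definition _ : EqQuotient _ equivf type := EqQuotient.on type.
HB.instance Definition _ := Choice.on type.

Definition addf x y : frac :=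
  mkfrac (num x * den y + num y * den x) (notinM (denP x) (denP y)).
Definition oppf x : frac := mkfrac (- num x) (denP x).
Definition mulf x y : frac := mkfrac (num x * num y) (notinM (denP x) (denP y)).

Definition add := lift_op2 type addf.
Definition opp := lift_op1 type oppf.
Definition mul := lift_op2 type mulf.

Definition tolocf (a : R) : frac := mkfrac a notin1.
Definition toloc := lift_embed type tolocf.
Canonical toloc_pi_morph := PiEmbed toloc.

Lemma equiv_repr x : equivf x (repr (\pi_type x)).
Proof. by apply/eqmodP; rewrite reprK. Qed.

Lemma pi_add : {morph \pi : x y / addf x y >-> add x y}.
Proof.
move=> x y; unlock add; apply/eqmodP => /=.
case/equivfP: (equiv_repr x) => u uP e; case/equivfP: (equiv_repr y) => v vP f.
apply/equivfP; move: (repr (\pi x)) (repr (\pi y)) e f => x' y' e f.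
exists (u * v); [exact: notinM | rewrite /num /den /=].
transitivity (v * den y * den y' * (u * (num x * den x' - num x' * den x))
   + u * den x * den x' * (v * (num y * den y' - num y' * den y))); first by ring.
by rewrite e f !mulr0 addr0.
Qed.
Canonical pi_add_morph := PiMorph2 pi_add.

Lemma pi_opp : {morph \pi : x / oppf x >-> opp x}.
Proof.
move=> x; unlock opp; apply/eqmodP => /=.
case/equivfP: (equiv_repr x) => u uP e; apply/equivfP; exists u => //.
by rewrite /= !mulNr -opprD mulrN e oppr0.
Qed.
Canonical pi_opp_morph := PiMorph1 pi_opp.

Lemma pi_mul : {morph \pi : x y / mulf x y >-> mul x y}.
Proof.
move=> x y; unlock mul; apply/eqmodP => /=.
case/equivfP: (equiv_repr x) => u uP e; case/equivfP: (equiv_repr y) => v vP f.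
apply/equivfP; move: (repr (\pi x)) (repr (\pi y)) e f => x' y' e f.
exists (u * v); [exact: notinM | rewrite /num /den /=].
transitivity (v * num y * den y' * (u * (num x * den x' - num x' * den x))
   + u * den x * num x' * (v * (num y * den y' - num y' * den y))); first by ring.
by rewrite e f !mulr0 addr0.
Qed.
Canonical pi_mul_morph := PiMorph2 pi_mul.

Lemma equivfW x y : num x * den y = num y * den x -> equivf x y.
Proof. by move=> e; apply/equivfP; exists 1; rewrite ?notin1 // e subrr mulr0. Qed.

Ltac frac_eq := rewrite !piE; apply/eqmodP/equivfW;
  do 3!rewrite /num /den /=; ring.

Lemma addA : associative add.
Proof. by elim/quotW=> x; elim/quotW=> y; elim/quotW=> z; frac_eq. Qed.

Lemma addC : commutative add.
Proof. by elim/quotW=> x; elim/quotW=> y; frac_eq. Qed.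

Lemma add0l : left_id (toloc 0) add.
Proof. by elim/quotW=> x; frac_eq. Qed.

Lemma addNl : left_inverse (toloc 0) opp add.
Proof. by elim/quotW=> x; frac_eq. Qed.

HB.instance Definition _ := GRing.isZmodule.Build type addA addC add0l addNl.

Lemma mulA : associative mul.
Proof. by elim/quotW=> x; elim/quotW=> y; elim/quotW=> z; frac_eq. Qed.

Lemma mulC : commutative mul.
Proof. by elim/quotW=> x; elim/quotW=> y; frac_eq. Qed.

Lemma mul1l : left_id (toloc 1) mul.
Proof. by elim/quotW=> x; frac_eq. Qed.

Lemma mulDl : left_distributive mul add.
Proof. by elim/quotW=> x; elim/quotW=> y; elim/quotW=> z; frac_eq. Qed.

Lemma one_neq0 : toloc 1 != toloc 0.
Proof.
rewrite piE; apply/negP=> /equivfP[u uP] /=.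
by rewrite mul0r subr0 !mulr1 => u0; rewrite u0 rpred0 in uP.
Qed.

HB.instance Definition _ :=
  GRing.Zmodule_isComNzRing.Build type mulA mulC mul1l mulDl one_neq0.

Lemma toloc_is_zmod_morphism : zmod_morphism toloc.
Proof.
move=> a b; unlock toloc; rewrite -[X in _ = _ + X]pi_opp -[RHS]pi_add.
by apply/eqmodP/equivfW; do 3!rewrite /num /den /=; ring.
Qed.
HB.instance Definition _ :=
  GRing.isZmodMorphism.Build R type toloc toloc_is_zmod_morphism.

Lemma toloc_is_monoid_morphism : monoid_morphism toloc.
Proof.
split=> // a b; unlock toloc; rewrite -[RHS]pi_mul.
by apply/eqmodP/equivfW; do 3!rewrite /num /den /=; ring.
Qed.
HB.instance Definition _ :=
  GRing.isMonoidMorphism.Build R type toloc toloc_is_monoid_morphism.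

End Localization.
End Localization.
HB.export Localization.

Notation localization := Localization.type.

Section LocalizationTheory.
Variables (R : comNzRingType) (p : prime_idealr R).
Local Notation "a %:L" := (@Localization.toloc R p a)
  (at level 2, left associativity, format "a %:L").

Lemma toloc_eqP (a b : R) :
  a%:L = b%:L <-> exists2 u : R, u \notin (p : pred R) & u * (a - b) = 0.
Proof.
unlock Localization.toloc; split=> [/eqmodP/Localization.equivfP | [u uP e]].
  by rewrite /Localization.num /Localization.den /= !mulr1.
apply/eqmodP/Localization.equivfP; exists u => //.
by rewrite /Localization.num /Localization.den /= !mulr1.
Qed.

Lemma toloc_inv (s : R) : s \notin (p : pred R) ->
  exists t : localization p, s%:L * t = 1.
Proof.
move=> sP; exists (\pi_(localization p) (Localization.mkfrac 1 sP)).
unlock Localization.toloc; rewrite -[LHS]Localization.pi_mul.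
rewrite -[RHS]/(1%:L); unlock Localization.toloc.
by apply/eqmodP/Localization.equivfW; do 2!rewrite /Localization.num /Localization.den /=; ring.
Qed.

Lemma toloc_surj (x : localization p) :
  exists a s : R, s \notin (p : pred R) /\ x * s%:L = a%:L.
Proof.
elim/quotW: x => x.
exists (Localization.num x), (Localization.den x); split; first exact: Localization.denP.
unlock Localization.toloc; rewrite -[LHS]Localization.pi_mul.
by apply/eqmodP/Localization.equivfW; do 2!rewrite /Localization.num /Localization.den /=; ring.
Qed.

End LocalizationTheory.

Export mpoly.

Section Automorphisms.
Variables (R : comNzRingType) (n : nat).

Definition polymap := n.-tuple {mpoly R[n]}.
Implicit Types phi psi : polymap.

Definition pm_id : polymap := [tuple 'X_i | i < n].

Definition pm_comp phi psi : polymap := [tuple tnth phi i \mPo psi | i < n].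

Definition pm_inverse phi psi : Prop :=
  pm_comp phi psi = pm_id /\ pm_comp psi phi = pm_id.

Definition GA phi : Prop := exists psi, pm_inverse phi psi.

(* Subgroup of GA_n(R) generated by S, when S is contained in GA_n(R). *)
Inductive generated (S : polymap -> Prop) : polymap -> Prop :=
| gen_base phi : S phi -> generated S phi
| gen_id : generated S pm_id
| gen_comp phi psi :
    generated S phi -> generated S psi -> generated S (pm_comp phi psi)
| gen_inv phi psi : generated S phi -> pm_inverse phi psi -> generated S psi.

(* f lies in R[X_1, ..., X_(i-1), X_(i+1), ..., X_n]. *)
Definition free_of (i : 'I_n) (f : {mpoly R[n]}) : Prop :=
  forall m, m \in msupp f -> m i = 0%N.

Definition elem_map (i : 'I_n) (f : {mpoly R[n]}) : polymap :=
  [tuple if j == i then 'X_i + f else 'X_j | j < n].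

Definition elementary phi : Prop :=
  exists (i : 'I_n) (f : {mpoly R[n]}), free_of i f /\ phi = elem_map i f.

Definition EA : polymap -> Prop := generated elementary.

Definition lin_map (A : 'M[R]_n) : polymap :=
  [tuple \sum_j A i j *: 'X_j | i < n].

(* Invertibility is spelled out since [unitmx] requires a comUnitRingType. *)
Definition GL phi : Prop :=
  exists A B : 'M[R]_n,
    [/\ A *m B = 1%:M, B *m A = 1%:M & phi = lin_map A].

Definition TA : polymap -> Prop := generated (fun phi => GL phi \/ EA phi).

End Automorphisms.

Arguments pm_id {R n}.

Definition pm_map (R S : comNzRingType) (f : {rmorphism R -> S}) (n : nat)
    (phi : polymap R n) : polymap S n :=
  [tuple map_mpoly f (tnth phi i) | i < n].

Definition pm_at (R : comNzRingType) (n : nat) (p : prime_idealr R)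
    (phi : polymap R n) : polymap (localization p) n :=
  pm_map (@Localization.toloc R p) phi.

Definition locally_tame (R : comNzRingType) (n : nat) (phi : polymap R n) : Prop :=
  forall p : prime_idealr R, TA (pm_at p phi).

Definition stabilize (R : comNzRingType) (n m : nat) (phi : polymap R n) :
    polymap R (n + m) :=
  [tuple match split i with
         | inl j => tnth phi j \mPo [tuple 'X_(lshift m k) | k < n]
         | inr j => 'X_(rshift n j)
         end | i < n + m].

Definition stably_tame (R : comNzRingType) (n : nat) (phi : polymap R n) : Prop :=
  exists m : nat, TA (stabilize m phi).

(* Main.v *)
From HB Require Import structures.
Require Import Defs.
From mathcomp Require Import all_boot all_algebra ring boolp classical_sets.

(* Write phi_t(X) = (phi(tX) - phi(0)) / t, which makes sense for every t in R;
   phi_0 is linear and phi_1 differs from phi by a translation.  As in Quillen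
   patching, the r in R such that phi_t^-1 o phi_(t+ru) is stably tame for all t
   and u form an ideal, and it suffices to find, for each prime p, an element of
   this ideal outside p.

   Over R_p, phi is a word in linear and elementary maps.  Since the difference
   quotient at a point obeys a chain rule, phi_t^-1 o phi_(t+s^k u) is then a
   product of conjugates, by tame maps, of elementary maps e_i(s^k g).  If k is
   large, such a conjugate becomes, after adding variables, a product of
   elementary maps e_j(s g_j): with a new variable y, e_i(s^2 g) is the commutator
   of e_i(s y) and e_y(s g), and the conjugate of each factor by a single
   elementary or linear map is a product of elementary maps with coefficients
   divisible by s.  Taking for s a variable and substituting d s for s, with d a
   common denominator, these elementary maps lift to R, and a further such
   substitution absorbs the torsion killed by localization. *)

Set Implicit Arguments.
Unset Strict Implicit.
Unset Printing Implicit Defensive.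

Import GRing.Theory.
Local Open Scope ring_scope.

(** * Polynomial maps *)

(** Constants and variables generate a polynomial ring; compatibilities between substitution, base
    change and evaluation are deduced from this. *)
Lemma mpoly_rmorph_ext (R A : comNzRingType) n (f g : {rmorphism {mpoly R[n]} -> A}) :
    (forall c, f c%:MP = g c%:MP) -> (forall i : 'I_n, f 'X_i = g 'X_i) ->
  f =1 g.
Proof.
move=> eC eX p; rewrite [p]mpolyE !rmorph_sum; apply: eq_bigr => m _.
rewrite -mul_mpolyC !rmorphM eC mpolyXE_id !rmorph_prod; congr (_ * _).
by apply: eq_bigr => i _; rewrite !rmorphXn eX.
Qed.

Section Composition.
Variable R : comNzRingType.

(** The rectangular form of [pm_comp]: the inclusion [emb] of n variables into N is not square. *)
Definition mcomp m n k (phi : m.-tuple {mpoly R[n]}) (psi : n.-tuple {mpoly R[k]}) :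
  m.-tuple {mpoly R[k]} := [tuple tnth phi i \mPo psi | i < m].

Lemma tnth_mcomp m n k (phi : m.-tuple {mpoly R[n]}) (psi : n.-tuple {mpoly R[k]}) i :
  tnth (mcomp phi psi) i = tnth phi i \mPo psi.
Proof. by rewrite tnth_mktuple. Qed.

Lemma tnth_pm_comp n (phi psi : polymap R n) i :
  tnth (pm_comp phi psi) i = tnth phi i \mPo psi.
Proof. exact: tnth_mktuple. Qed.

Lemma tnth_pm_id n i : tnth (@pm_id R n) i = 'X_i.
Proof. exact: tnth_mktuple. Qed.

Lemma comp_mpolyXi n k (i : 'I_n) (psi : n.-tuple {mpoly R[k]}) :
  'X_i \mPo psi = tnth psi i.
Proof. by rewrite comp_mpolyXU -tnth_nth. Qed.

Lemma comp_mpolyA n k l (p : {mpoly R[n]}) (phi : n.-tuple {mpoly R[k]})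
    (psi : k.-tuple {mpoly R[l]}) :
  (p \mPo phi) \mPo psi = p \mPo mcomp phi psi.
Proof.
pose f : {rmorphism {mpoly R[n]} -> {mpoly R[l]}} := comp_mpoly psi \o comp_mpoly phi.
apply: (@mpoly_rmorph_ext _ _ _ f (comp_mpoly (mcomp phi psi))) => [c|i] /=.
  by rewrite !comp_mpolyC.
by rewrite !comp_mpolyXi tnth_mcomp.
Qed.

Lemma mcompA m n k l (chi : m.-tuple {mpoly R[n]}) (phi : n.-tuple {mpoly R[k]})
    (psi : k.-tuple {mpoly R[l]}) :
  mcomp (mcomp chi phi) psi = mcomp chi (mcomp phi psi).
Proof. by apply: eq_from_tnth => i; rewrite !tnth_mcomp comp_mpolyA. Qed.

Lemma pm_compA n (chi phi psi : polymap R n) :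
  pm_comp (pm_comp chi phi) psi = pm_comp chi (pm_comp phi psi).
Proof. exact: mcompA. Qed.

Lemma pm_comp1p n (phi : polymap R n) : pm_comp pm_id phi = phi.
Proof. by apply: eq_from_tnth => i; rewrite tnth_pm_comp tnth_pm_id comp_mpolyXi. Qed.

Lemma pm_compp1 n (phi : polymap R n) : pm_comp phi pm_id = phi.
Proof. by apply: eq_from_tnth => i; rewrite tnth_pm_comp comp_mpoly_id. Qed.

Lemma pm_inverse_uniq n (phi psi chi : polymap R n) :
  pm_inverse phi psi -> pm_inverse phi chi -> psi = chi.
Proof.
move=> [_ e] [f _].
by rewrite -[psi]pm_compp1 -f -pm_compA e pm_comp1p.
Qed.

Lemma pm_inverse_comp n (phi phi' psi psi' : polymap R n) :
  pm_inverse phi phi' -> pm_inverse psi psi' ->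
  pm_inverse (pm_comp phi psi) (pm_comp psi' phi').
Proof.
move=> [e1 e2] [f1 f2]; split.
  by rewrite pm_compA -(pm_compA psi) f1 pm_comp1p.
by rewrite pm_compA -(pm_compA phi') e2 pm_comp1p.
Qed.

Lemma pm_inverse_id n : pm_inverse (@pm_id R n) pm_id.
Proof. by split; rewrite pm_comp1p. Qed.

Lemma eq_comp_mpoly n k (f : {mpoly R[n]}) (phi psi : n.-tuple {mpoly R[k]}) :
  (forall m j, m \in msupp f -> m j != 0%N -> tnth phi j = tnth psi j) ->
  f \mPo phi = f \mPo psi.
Proof.
move=> e; rewrite !comp_mpolyE; apply: eq_big_seq => m mf.
congr (_ *: _); apply: eq_bigr => j _.
by have [-> | mj] := eqVneq (m j) 0%N; rewrite ?expr0 // (e m).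
Qed.

Lemma free_of_comp_eq n k (i : 'I_n) f (phi psi : n.-tuple {mpoly R[k]}) :
  free_of i f -> (forall j, j != i -> tnth phi j = tnth psi j) ->
  f \mPo phi = f \mPo psi.
Proof.
move=> fi e; apply: eq_comp_mpoly => m j mf mj; apply: e.
by apply: contraNneq mj => ->; rewrite fi.
Qed.

End Composition.

(** * Polynomials not involving a variable *)

Section FreeOf.
Variables (R : comNzRingType) (n : nat) (i : 'I_n).
Implicit Types f g : {mpoly R[n]}.

Lemma free_ofC c : free_of i (c%:MP : {mpoly R[n]}).
Proof. by move=> m; rewrite msuppC; case: ifP => // _; rewrite inE => /eqP->; rewrite mnm0E. Qed.

Lemma free_of0 : free_of i (0 : {mpoly R[n]}).
Proof. by move=> m; rewrite mcoeff_msupp mcoeff0 eqxx. Qed.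

Lemma free_of1 : free_of i (1 : {mpoly R[n]}).
Proof. by move=> m; rewrite msupp1 inE => /eqP->; rewrite mnm0E. Qed.

Lemma free_ofX j : j != i -> free_of i ('X_j : {mpoly R[n]}).
Proof. by move=> ji m; rewrite msuppX inE => /eqP->; rewrite mnm1E (negbTE ji). Qed.

Lemma free_ofD f g : free_of i f -> free_of i g -> free_of i (f + g).
Proof. by move=> fi gi m /msuppD_le; rewrite mem_cat => /orP[/fi|/gi]. Qed.

Lemma free_ofM f g : free_of i f -> free_of i g -> free_of i (f * g).
Proof.
move=> fi gi m /msuppM_le /allpairsP[[m1 m2] /= [/fi e1 /gi e2 ->]].
by rewrite mnmDE e1 e2.
Qed.

Lemma free_ofZ c f : free_of i f -> free_of i (c *: f).
Proof. by rewrite -mul_mpolyC; apply: free_ofM; apply: free_ofC. Qed.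

Lemma free_ofN f : free_of i f -> free_of i (- f).
Proof. by rewrite -scaleN1r; apply: free_ofZ. Qed.

Lemma free_of_sum (I : Type) (r : seq I) (P : pred I) (F : I -> {mpoly R[n]}) :
  (forall j, P j -> free_of i (F j)) -> free_of i (\sum_(j <- r | P j) F j).
Proof. by move=> Fi; elim/big_rec: _ => [|j f Pj]; [exact: free_of0 | apply/free_ofD/Fi]. Qed.

Lemma free_of_prod (I : Type) (r : seq I) (P : pred I) (F : I -> {mpoly R[n]}) :
  (forall j, P j -> free_of i (F j)) -> free_of i (\prod_(j <- r | P j) F j).
Proof.
move=> Fi; elim/big_rec: _ => [|j f Pj]; last by apply/free_ofM/Fi.
exact: free_of1.
Qed.

Lemma free_ofXn f k : free_of i f -> free_of i (f ^+ k).
Proof.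
by move=> fi; elim: k => [|k IH]; rewrite ?exprS; [exact: free_of1 | apply: free_ofM].
Qed.

Lemma free_of_comp k (h : {mpoly R[k]}) (psi : k.-tuple {mpoly R[n]}) :
    (forall m j, m \in msupp h -> m j != 0%N -> free_of i (tnth psi j)) ->
  free_of i (h \mPo psi).
Proof.
move=> psii; rewrite comp_mpolyE big_seq; apply: free_of_sum => m mh.
apply/free_ofZ/free_of_prod => j _.
have [-> | mj] := eqVneq (m j) 0%N; last exact/free_ofXn/(psii m).
by rewrite expr0; apply: free_of1.
Qed.

(** A projection onto the polynomials free of X_i. It removes X_i from cofactors and lifts that were
    obtained without control over that variable. *)
Definition zero_at : polymap R n := [tuple if j == i then 0 else 'X_j | j < n].

Lemma zero_at_free f : free_of i (f \mPo zero_at).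
Proof.
apply: free_of_comp => m j _ _; rewrite tnth_mktuple.
by case: eqP => [_|/eqP]; [exact: free_of0 | exact: free_ofX].
Qed.

Lemma zero_at_id f : free_of i f -> f \mPo zero_at = f.
Proof.
move=> fi; rewrite -[RHS]comp_mpoly_id; apply: (free_of_comp_eq fi) => j /negbTE ji.
by rewrite !tnth_mktuple ji.
Qed.

End FreeOf.

(** * Elementary and linear maps *)

Section Elementary.
Variables (R : comNzRingType) (n : nat).
Implicit Types (i j : 'I_n) (f g : {mpoly R[n]}) (phi psi : polymap R n).

Lemma tnth_elem_map i f j :
  tnth (elem_map i f) j = if j == i then 'X_i + f else 'X_j.
Proof. by rewrite tnth_mktuple. Qed.

Lemma tnth_elem_mapC i f phi j :
  tnth (pm_comp (elem_map i f) phi) j =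
  if j == i then tnth phi i + (f \mPo phi) else tnth phi j.
Proof.
rewrite tnth_pm_comp tnth_elem_map; have [_|_] := eqVneq j i.
  by rewrite comp_mpolyD comp_mpolyXi.
by rewrite comp_mpolyXi.
Qed.

Lemma elem_map0 i : elem_map i (0 : {mpoly R[n]}) = pm_id.
Proof.
apply: eq_from_tnth => j; rewrite tnth_elem_map tnth_pm_id addr0.
by have [->|] := eqVneq j i.
Qed.

Lemma elem_mapD i f g :
  free_of i f -> pm_comp (elem_map i f) (elem_map i g) = elem_map i (f + g).
Proof.
move=> fi; apply: eq_from_tnth => j; rewrite tnth_elem_mapC !tnth_elem_map eqxx.
case: eqP => // _; rewrite -addrA; congr (_ + _); rewrite addrC; congr (_ + _).
rewrite -[RHS]comp_mpoly_id; apply: (free_of_comp_eq fi) => k /negbTE ki.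
by rewrite tnth_elem_map tnth_mktuple ki.
Qed.

Lemma elem_map_inverse i f :
  free_of i f -> pm_inverse (elem_map i f) (elem_map i (- f)).
Proof.
by move=> fi; split; rewrite elem_mapD ?subrr ?addNr ?elem_map0 //; apply: free_ofN.
Qed.

Lemma tnth_lin_map (A : 'M[R]_n) i : tnth (lin_map A) i = \sum_j A i j *: 'X_j.
Proof. exact: tnth_mktuple. Qed.

Lemma lin_mapM (A B : 'M[R]_n) : pm_comp (lin_map A) (lin_map B) = lin_map (A *m B).
Proof.
apply: eq_from_tnth => i; rewrite tnth_pm_comp !tnth_lin_map linear_sum /=.
under eq_bigr => j _ do rewrite comp_mpolyZ comp_mpolyXi tnth_lin_map scaler_sumr.
rewrite exchange_big; apply: eq_bigr => k _ /=.
by rewrite mxE scaler_suml; apply: eq_bigr => j _; rewrite scalerA.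
Qed.

Lemma lin_map1 : lin_map (1%:M : 'M[R]_n) = pm_id.
Proof.
apply: eq_from_tnth => i; rewrite tnth_lin_map tnth_pm_id (bigD1 i) //= mxE eqxx scale1r.
rewrite big1 ?addr0 // => j ji; rewrite mxE eq_sym (negbTE ji).
by rewrite scale0r.
Qed.

Lemma mcoeff_lin_map (A : 'M[R]_n) i j : (tnth (lin_map A) i)@_(U_(j)) = A i j.
Proof.
rewrite tnth_lin_map raddf_sum /= (bigD1 j) //= mcoeffZ mcoeffXU eqxx mulr1.
by rewrite big1 ?addr0 // => k kj; rewrite mcoeffZ mcoeffXU (negbTE kj) mulr0.
Qed.

Lemma lin_map_inj : injective (@lin_map R n).
Proof.
by move=> A B e; apply/matrixP=> i j; rewrite -!mcoeff_lin_map e.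
Qed.

Lemma lin_map_GL (A B : 'M[R]_n) : pm_inverse (lin_map A) (lin_map B) -> GL (lin_map A).
Proof.
case; rewrite !lin_mapM -lin_map1 => /lin_map_inj e1 /lin_map_inj e2.
by exists A, B.
Qed.

Lemma GL_inverse phi :
  GL phi -> exists2 psi, GL psi & pm_inverse phi psi.
Proof.
case=> A [B [AB BA ->]]; exists (lin_map B); first by exists B, A.
by split; rewrite lin_mapM ?AB ?BA lin_map1.
Qed.

End Elementary.

(** * Subgroups as sets of words *)

Section Words.
Variables (R : comNzRingType) (n : nat).
Implicit Types (phi psi : polymap R n) (S T : polymap R n -> Prop).

(** Products without formal inverses. For S closed under inverses they form the generated subgroup,
    and inductions then have only two cases. *)
Inductive words S : polymap R n -> Prop :=
| words_id : words S pm_id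
| words_cons g w : S g -> words S w -> words S (pm_comp g w).

Lemma words_base S g : S g -> words S g.
Proof. by move=> Sg; rewrite -[g]pm_compp1; apply: words_cons Sg _; apply: words_id. Qed.

Lemma words_comp S phi psi : words S phi -> words S psi -> words S (pm_comp phi psi).
Proof.
by move=> Sphi Spsi; elim: Sphi => [|g w Sg _ IH]; rewrite ?pm_comp1p // pm_compA; apply: words_cons.
Qed.

Lemma words_sub S T : (forall g, S g -> words T g) -> forall w, words S w -> words T w.
Proof.
move=> ST w; elim=> [|g {}w Sg _ IH]; first exact: words_id.
exact: words_comp (ST _ Sg) IH.
Qed.

Lemma words_generated S w : words S w -> generated S w.
Proof.
by elim=> [|g {}w Sg _ IH]; [exact: gen_id | apply: gen_comp => //; apply: gen_base].
Qed.

Section Inverse.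
Variable S : polymap R n -> Prop.
Hypothesis S_inv : forall g, S g -> exists2 h, S h & pm_inverse g h.

Lemma words_inverse w : words S w -> exists2 v, words S v & pm_inverse w v.
Proof.
elim=> [|g {}w Sg _ [v Sv wv]]; first by exists pm_id; [exact: words_id | exact: pm_inverse_id].
have [h Sh gh] := S_inv Sg; exists (pm_comp v h); last exact: pm_inverse_comp.
by apply: words_comp Sv _; apply: words_base.
Qed.

Lemma generated_words w : generated S w -> words S w.
Proof.
elim=> [g /words_base //||phi psi _ + _|phi psi _ Sphi phiK]; first exact: words_id.
  exact: words_comp.
have [v Sv phiv] := words_inverse Sphi.
by rewrite -(pm_inverse_uniq phiv phiK).
Qed.

End Inverse.

End Words.

Lemma words_elementary_EA (R : comNzRingType) n (phi : polymap R n) :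
  EA phi <-> words (@elementary R n) phi.
Proof.
split; last exact: words_generated.
apply: generated_words => _ [i [f [fi ->]]].
exists (elem_map i (- f)); last exact: elem_map_inverse.
by exists i, (- f); split=> //; apply: free_ofN.
Qed.

(** Single elementary maps replace the whole group [EA], so that an induction on tame words meets
    one explicit generator at a time. *)
Definition tame_gen (R : comNzRingType) n (phi : polymap R n) : Prop :=
  GL phi \/ elementary phi.

Lemma tame_gen_inverse (R : comNzRingType) n (g : polymap R n) :
  tame_gen g -> exists2 h, tame_gen h & pm_inverse g h.
Proof.
case=> [/GL_inverse[h hGL gh] | [i [f [fi ->]]]]; first by exists h => //; left.
exists (elem_map i (- f)); last exact: elem_map_inverse.
by right; exists i, (- f); split=> //; apply: free_ofN.
Qed.

Lemma TA_words (R : comNzRingType) n (phi : polymap R n) :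
  TA phi <-> words (@tame_gen R n) phi.
Proof.
split=> [|w].
  elim=> [g [gGL|/words_elementary_EA]||psi chi _ + _|psi chi _ w psiK].
  - by apply: words_base; left.
  - by apply: words_sub => h hel; apply: words_base; right.
  - exact: words_id.
  - exact: words_comp.
  have [v Sv psiv] := words_inverse (@tame_gen_inverse R n) w.
  by rewrite -(pm_inverse_uniq psiv psiK).
apply: words_generated; apply: words_sub w => g [] gg; apply: words_base; first by left.
by right; apply: gen_base.
Qed.

(** * Change of rings *)

Section BaseChange.
Variables (R S : comNzRingType) (h : {rmorphism R -> S}).

(* [mcoeff_map_mpoly] for ring morphisms: its own right-hand side is headed by
   the additive coercion, on which the [rmorph] lemmas do not fire. *)
Lemma mcoeff_map n (f : {mpoly R[n]}) m : (map_mpoly h f)@_m = h f@_m.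
Proof. exact: mcoeff_map_mpoly. Qed.

Lemma map_mpolyXi n (i : 'I_n) : map_mpoly h 'X_i = 'X_i.
Proof. exact: map_mpolyX. Qed.

Lemma map_mpoly_comp n k (p : {mpoly R[n]}) (q : n.-tuple {mpoly R[k]}) :
  map_mpoly h (p \mPo q) = map_mpoly h p \mPo [tuple map_mpoly h (tnth q i) | i < n].
Proof.
set q' := [tuple _ | i < n].
pose f : {rmorphism {mpoly R[n]} -> {mpoly S[k]}} := map_mpoly h \o comp_mpoly q.
pose g : {rmorphism {mpoly R[n]} -> {mpoly S[k]}} := comp_mpoly q' \o map_mpoly h.
apply: (@mpoly_rmorph_ext _ _ _ f g) => [c|i] /=.
  by rewrite map_mpolyC !comp_mpolyC map_mpolyC.
by rewrite map_mpolyXi !comp_mpolyXi tnth_mktuple.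
Qed.

Lemma tnth_pm_map n (phi : polymap R n) i :
  tnth (pm_map h phi) i = map_mpoly h (tnth phi i).
Proof. exact: tnth_mktuple. Qed.

Lemma pm_map_comp n (phi psi : polymap R n) :
  pm_map h (pm_comp phi psi) = pm_comp (pm_map h phi) (pm_map h psi).
Proof.
by apply: eq_from_tnth => i; rewrite tnth_pm_map !tnth_pm_comp map_mpoly_comp tnth_pm_map.
Qed.

Lemma pm_map1 n : pm_map h (@pm_id R n) = pm_id.
Proof. by apply: eq_from_tnth => i; rewrite tnth_pm_map !tnth_pm_id map_mpolyXi. Qed.

Lemma pm_map_inverse n (phi psi : polymap R n) :
  pm_inverse phi psi -> pm_inverse (pm_map h phi) (pm_map h psi).
Proof. by case=> e1 e2; split; rewrite -pm_map_comp ?e1 ?e2 pm_map1. Qed.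

Lemma free_of_map n (i : 'I_n) (f : {mpoly R[n]}) :
  free_of i f -> free_of i (map_mpoly h f).
Proof.
move=> fi m; rewrite mcoeff_msupp mcoeff_map => hm; apply: fi.
rewrite mcoeff_msupp; apply: contraNneq hm => ->. by rewrite rmorph0.
Qed.

Lemma pm_map_elem n (i : 'I_n) (f : {mpoly R[n]}) :
  pm_map h (elem_map i f) = elem_map i (map_mpoly h f).
Proof.
apply: eq_from_tnth => j; rewrite tnth_pm_map !tnth_elem_map.
by case: ifP => _; rewrite ?rmorphD /= !map_mpolyXi.
Qed.

Lemma pm_map_lin n (A : 'M[R]_n) : pm_map h (lin_map A) = lin_map (map_mx h A).
Proof.
apply: eq_from_tnth => i; rewrite tnth_pm_map !tnth_lin_map rmorph_sum /=.
by apply: eq_bigr => j _; rewrite map_mpolyZ map_mpolyXi mxE.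
Qed.

Lemma pm_map_words n (T : polymap R n -> Prop) (U : polymap S n -> Prop) w :
  (forall g, T g -> U (pm_map h g)) -> words T w -> words U (pm_map h w).
Proof.
move=> TU; elim=> [|g {}w Tg _ IH]; rewrite ?pm_map1 ?pm_map_comp; first exact: words_id.
exact: words_cons (TU _ Tg) IH.
Qed.

Lemma pm_map_elementary n (phi : polymap R n) :
  elementary phi -> elementary (pm_map h phi).
Proof.
case=> i [f [fi ->]]; exists i, (map_mpoly h f); rewrite pm_map_elem.
by split=> //; apply: free_of_map.
Qed.

Lemma pm_map_GL n (phi : polymap R n) : GL phi -> GL (pm_map h phi).
Proof.
case=> A [B [AB BA ->]]; exists (map_mx h A), (map_mx h B).
by rewrite pm_map_lin -!map_mxM AB BA !map_mx1.
Qed.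

Lemma pm_map_tame_gen n (phi : polymap R n) : tame_gen phi -> tame_gen (pm_map h phi).
Proof. by case=> [/pm_map_GL|/pm_map_elementary]; [left | right]. Qed.

Lemma pm_map_TA n (phi : polymap R n) : TA phi -> TA (pm_map h phi).
Proof. by rewrite !TA_words; apply: pm_map_words => g; apply: pm_map_tame_gen. Qed.

End BaseChange.

Lemma eq_pm_map (R S : comNzRingType) (f g : {rmorphism R -> S}) n (phi : polymap R n) :
  f =1 g -> pm_map f phi = pm_map g phi.
Proof.
move=> fg; apply: eq_from_tnth => i; rewrite !tnth_pm_map.
by apply/mpolyP => m; rewrite !mcoeff_map fg.
Qed.

Lemma pm_map_id (R : comNzRingType) (f : {rmorphism R -> R}) n (phi : polymap R n) :
  f =1 id -> pm_map f phi = phi.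
Proof.
move=> fg; apply: eq_from_tnth => i; rewrite !tnth_pm_map.
by apply/mpolyP => m; rewrite !mcoeff_map fg.
Qed.

Lemma pm_mapM (R S T : comNzRingType) (f : {rmorphism S -> T}) (g : {rmorphism R -> S}) n
    (phi : polymap R n) :
  pm_map f (pm_map g phi) = pm_map (f \o g) phi.
Proof.
apply: eq_from_tnth => i; rewrite !tnth_pm_map.
by apply/mpolyP => m; rewrite !mcoeff_map.
Qed.

(** * Stabilization *)

Section Stabilization.
Variable R : comNzRingType.

(* [stab N phi] is phi^[N-n] for n <= N; indexing by the number of variables
   of the target avoids casts between n + (m + k) and (n + m) + k. *)
Definition var_or_0 N (k : nat) : {mpoly R[N]} :=
  if insub k is Some i then 'X_(i : 'I_N) else 0.

Definition emb n N : n.-tuple {mpoly R[N]} := [tuple var_or_0 N k | k < n].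

Definition stab n N (phi : polymap R n) : polymap R N :=
  [tuple if insub (j : nat) is Some i then tnth phi (i : 'I_n) \mPo emb n N else 'X_j
  | j < N].

Lemma var_or_0E N (i : 'I_N) : var_or_0 N i = 'X_i.
Proof. by rewrite /var_or_0; case: insubP => [j _ /val_inj-> //|]; rewrite ltn_ord. Qed.

Lemma var_or_0_lt N k (kN : (k < N)%N) : var_or_0 N k = 'X_(Ordinal kN).
Proof. exact: (var_or_0E (Ordinal kN)). Qed.

Lemma tnth_emb n N (k : 'I_n) : tnth (emb n N) k = var_or_0 N k.
Proof. exact: tnth_mktuple. Qed.

Lemma tnth_stab_lt n N (phi : polymap R n) (j : 'I_N) (jn : (j < n)%N) :
  tnth (stab N phi) j = tnth phi (Ordinal jn) \mPo emb n N.
Proof. by rewrite tnth_mktuple insubT. Qed.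

Lemma tnth_stab_ge n N (phi : polymap R n) (j : 'I_N) :
  (n <= j)%N -> tnth (stab N phi) j = 'X_j.
Proof. by move=> nj; rewrite tnth_mktuple insubF // ltnNge nj. Qed.

Lemma tnth_stab_ord n N (phi : polymap R n) (k : 'I_n) (kN : (k < N)%N) :
  tnth (stab N phi) (Ordinal kN) = tnth phi k \mPo emb n N.
Proof. by rewrite (tnth_stab_lt _ (j := Ordinal kN) (ltn_ord k)); congr (tnth _ _ \mPo _); apply: val_inj. Qed.

Lemma emb_stab n N (phi : polymap R n) :
  (n <= N)%N -> mcomp (emb n N) (stab N phi) = mcomp phi (emb n N).
Proof.
move=> nN; apply: eq_from_tnth => k; rewrite !tnth_mcomp tnth_emb.
by rewrite (var_or_0_lt (leq_trans (ltn_ord k) nN)) comp_mpolyXi tnth_stab_ord.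
Qed.

Lemma emb_emb n M N : (n <= M)%N -> mcomp (emb n M) (emb M N) = emb n N.
Proof.
move=> nM; apply: eq_from_tnth => k; rewrite tnth_mcomp !tnth_emb.
by rewrite (var_or_0_lt (leq_trans (ltn_ord k) nM)) comp_mpolyXi tnth_emb.
Qed.

Lemma stab_comp n N (phi psi : polymap R n) : (n <= N)%N ->
  stab N (pm_comp phi psi) = pm_comp (stab N phi) (stab N psi).
Proof.
move=> nN; apply: eq_from_tnth => j; rewrite tnth_pm_comp.
have [jn|nj] := ltnP j n; last by rewrite !tnth_stab_ge // comp_mpolyXi tnth_stab_ge.
by rewrite !(tnth_stab_lt _ jn) tnth_pm_comp !comp_mpolyA emb_stab.
Qed.

Lemma stab1 n N : stab N (@pm_id R n) = pm_id.
Proof.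
apply: eq_from_tnth => j; rewrite tnth_pm_id.
have [jn|nj] := ltnP j n; last by rewrite tnth_stab_ge.
by rewrite (tnth_stab_lt _ jn) tnth_pm_id comp_mpolyXi tnth_emb var_or_0E.
Qed.

Lemma stab_inverse n N (phi psi : polymap R n) : (n <= N)%N ->
  pm_inverse phi psi -> pm_inverse (stab N phi) (stab N psi).
Proof. by move=> nN [e1 e2]; split; rewrite -stab_comp ?e1 ?e2 ?stab1. Qed.

Lemma stab_stab n M N (phi : polymap R n) : (n <= M)%N -> (M <= N)%N ->
  stab N (stab M phi) = stab N phi.
Proof.
move=> nM MN; apply: eq_from_tnth => j.
have [jn|nj] := ltnP j n.
  rewrite (tnth_stab_lt _ jn) (tnth_stab_lt _ (leq_trans jn nM)).
  by rewrite (tnth_stab_lt _ (j := Ordinal _) jn) comp_mpolyA emb_emb.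
rewrite (tnth_stab_ge _ nj).
have [jM|Mj] := ltnP j M; last by rewrite tnth_stab_ge.
by rewrite (tnth_stab_lt _ jM) tnth_stab_ge // comp_mpolyXi tnth_emb var_or_0E.
Qed.

Lemma comp_emb_id n (f : {mpoly R[n]}) : f \mPo emb n n = f.
Proof.
rewrite -[RHS]comp_mpoly_id; congr (_ \mPo _).
by apply: eq_from_tnth => k; rewrite tnth_emb tnth_mktuple var_or_0E.
Qed.

Lemma stab_refl n (phi : polymap R n) : stab n phi = phi.
Proof.
apply: eq_from_tnth => k; rewrite (tnth_stab_lt _ (ltn_ord k)) comp_emb_id.
by congr (tnth _ _); apply: val_inj.
Qed.

Lemma stabilizeE n m (phi : polymap R n) : stabilize m phi = stab (n + m) phi.
Proof.
apply: eq_from_tnth => j; rewrite tnth_mktuple.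
case: (splitP j) => k jk; last first.
  by rewrite tnth_stab_ge ?jk ?leq_addr //; congr 'X_ _; apply: val_inj.
have jn : (j < n)%N by rewrite jk.
rewrite (tnth_stab_lt _ jn) (_ : Ordinal jn = k); last exact: val_inj.
congr (_ \mPo _); apply: eq_from_tnth => l; rewrite tnth_mktuple tnth_emb.
by rewrite -(var_or_0E (lshift m l)).
Qed.

Lemma free_of_emb n N (i : 'I_n) (iN : (i < N)%N) (f : {mpoly R[n]}) :
  free_of i f -> free_of (Ordinal iN) (f \mPo emb n N).
Proof.
move=> fi; apply: free_of_comp => m j mf mj; rewrite tnth_emb /var_or_0.
case: insubP => [k _ kj|_]; last exact: free_of0.
apply: free_ofX; rewrite -val_eqE kj /=; apply: contraNneq mj => ji.
by rewrite (val_inj ji) fi.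
Qed.

Lemma free_of_emb_new n N (i : 'I_N) (f : {mpoly R[n]}) :
  (n <= i)%N -> free_of i (f \mPo emb n N).
Proof.
move=> ni; apply: free_of_comp => m j _ _; rewrite tnth_emb /var_or_0.
case: insubP => [k _ kj|_]; last exact: free_of0.
by apply: free_ofX; rewrite -val_eqE kj /= neq_ltn (leq_trans (ltn_ord j) ni).
Qed.

Lemma stab_elem n N (i : 'I_n) (iN : (i < N)%N) (f : {mpoly R[n]}) :
  stab N (elem_map i f) = elem_map (Ordinal iN) (f \mPo emb n N).
Proof.
apply: eq_from_tnth => j; rewrite tnth_elem_map -[j == _]val_eqE /=.
have [jn|nj] := ltnP j n; last first.
  by rewrite tnth_stab_ge // gtn_eqF // (leq_trans (ltn_ord i)).
rewrite (tnth_stab_lt _ jn) tnth_elem_map -[Ordinal jn == _]val_eqE /=.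
case: ifP => _; rewrite ?comp_mpolyD comp_mpolyXi tnth_emb; last by rewrite var_or_0E.
by rewrite var_or_0_lt.
Qed.

Lemma stab_elementary n N (phi : polymap R n) : (n <= N)%N ->
  elementary phi -> elementary (stab N phi).
Proof.
move=> nN [i [f [fi ->]]]; have iN := leq_trans (ltn_ord i) nN.
exists (Ordinal iN), (f \mPo emb n N); rewrite stab_elem.
by split=> //; apply: free_of_emb.
Qed.

Lemma stab_lin n N (A : 'M[R]_n) : (n <= N)%N ->
  exists B : 'M[R]_N, stab N (lin_map A) = lin_map B.
Proof.
(* The matrix is read off the linear coefficients, which avoids block matrices over a cast index
   type. *)
move=> nN; exists (\matrix_(i, j) (tnth (stab N (lin_map A)) i)@_(U_(j))).
apply: eq_from_tnth => i; rewrite tnth_lin_map.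
under eq_bigr => j _ do rewrite mxE.
have [jn|nj] := ltnP i n; last first.
  rewrite (tnth_stab_ge _ nj) (bigD1 i) //= mcoeffXU eqxx scale1r big1 ?addr0 //.
  by move=> j ji; rewrite mcoeffXU eq_sym (negbTE ji) scale0r.
rewrite (tnth_stab_lt _ jn) tnth_lin_map.
have -> : (\sum_j A (Ordinal jn) j *: 'X_j) \mPo emb n N =
    \sum_j A (Ordinal jn) j *: 'X_(widen_ord nN j) :> {mpoly R[N]}.
  rewrite linear_sum; apply: eq_bigr => j _ /=.
  by rewrite comp_mpolyZ comp_mpolyXi tnth_emb -(var_or_0E (widen_ord nN j)).
under [RHS]eq_bigr => k _ do rewrite raddf_sum scaler_suml /=.
rewrite exchange_big; apply: eq_bigr => j _ /=.
rewrite (bigD1 (widen_ord nN j)) //= mcoeffZ mcoeffXU eqxx mulr1 big1 ?addr0 //.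
by move=> k kj; rewrite mcoeffZ mcoeffXU eq_sym (negbTE kj) mulr0 scale0r.
Qed.

Lemma stab_GL n N (phi : polymap R n) : (n <= N)%N -> GL phi -> GL (stab N phi).
Proof.
move=> nN [A [B [AB BA ->]]].
have [A' eA] := stab_lin A nN; have [B' eB] := stab_lin B nN.
have : pm_inverse (lin_map A) (lin_map B) by split; rewrite lin_mapM ?AB ?BA lin_map1.
by move/(stab_inverse nN); rewrite eA eB; apply: lin_map_GL.
Qed.

Lemma stab_tame_gen n N (phi : polymap R n) : (n <= N)%N ->
  tame_gen phi -> tame_gen (stab N phi).
Proof. by move=> nN [/(stab_GL nN)|/(stab_elementary nN)]; [left|right]. Qed.

Lemma stab_words n N (T : polymap R n -> Prop) (U : polymap R N -> Prop) w : (n <= N)%N ->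
  (forall g, T g -> U (stab N g)) -> words T w -> words U (stab N w).
Proof.
move=> nN TU; elim=> [|g {}w Tg _ IH]; rewrite ?stab1 ?stab_comp //; first exact: words_id.
exact: words_cons (TU _ Tg) IH.
Qed.

Lemma stab_TA n N (phi : polymap R n) : (n <= N)%N -> TA phi -> TA (stab N phi).
Proof. by move=> nN; rewrite !TA_words; apply: stab_words => // g; apply: stab_tame_gen. Qed.

End Stabilization.

Arguments emb {R}.

Lemma pm_map_stab (R S : comNzRingType) (h : {rmorphism R -> S}) n N (phi : polymap R n) :
  pm_map h (stab N phi) = stab N (pm_map h phi).
Proof.
apply: eq_from_tnth => j; rewrite tnth_pm_map.
have [jn|nj] := ltnP j n; last by rewrite !tnth_stab_ge // map_mpolyXi.
rewrite !(tnth_stab_lt _ jn) map_mpoly_comp tnth_pm_map; congr (_ \mPo _).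
apply: eq_from_tnth => k; rewrite tnth_mktuple !tnth_emb /var_or_0.
by case: insubP => [l _ _|_]; rewrite ?map_mpolyXi ?rmorph0.
Qed.

Lemma stably_tameP (R : comNzRingType) n (phi : polymap R n) :
  stably_tame phi <-> exists2 N, (n <= N)%N & TA (stab N phi).
Proof.
split=> [[m]|[N nN]]; first by rewrite stabilizeE; exists (n + m)%N; rewrite ?leq_addr.
by exists (N - n)%N; rewrite stabilizeE subnKC.
Qed.

Lemma stably_tame_comp (R : comNzRingType) n (phi psi : polymap R n) :
  stably_tame phi -> stably_tame psi -> stably_tame (pm_comp phi psi).
Proof.
rewrite !stably_tameP => -[M nM tM] [N nN tN].
have nMN : (n <= maxn M N)%N by rewrite leq_max nM.
exists (maxn M N) => //; rewrite stab_comp //; apply: gen_comp.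
  by rewrite -(stab_stab _ nM) ?leq_maxl //; apply: stab_TA; rewrite ?leq_maxl.
by rewrite -(stab_stab _ nN) ?leq_maxr //; apply: stab_TA; rewrite ?leq_maxr.
Qed.

Lemma TA_stably_tame (R : comNzRingType) n (phi : polymap R n) : TA phi -> stably_tame phi.
Proof. by move=> t; apply/stably_tameP; exists n; rewrite ?stab_refl. Qed.

(* Failed unifications would otherwise unfold polynomial maps down to tuples. *)
Opaque pm_comp mcomp pm_id elem_map lin_map stab emb comp_mpoly.

(** * Elementary maps congruent to the identity *)

Section ScalarMultiple.
Variables (R : comNzRingType) (s : R).

Definition smul n (f : {mpoly R[n]}) : Prop := exists v, f = s *: v.

Lemma smul0 n : smul (0 : {mpoly R[n]}).
Proof. by exists 0; rewrite scaler0. Qed.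

Lemma smulD n (f g : {mpoly R[n]}) : smul f -> smul g -> smul (f + g).
Proof. by move=> [v ->] [w ->]; exists (v + w); rewrite scalerDr. Qed.

Lemma smulN n (f : {mpoly R[n]}) : smul f -> smul (- f).
Proof. by move=> [v ->]; exists (- v); rewrite scalerN. Qed.

Lemma smulMl n (f g : {mpoly R[n]}) : smul g -> smul (f * g).
Proof. by move=> [v ->]; exists (f * v); rewrite scalerAr. Qed.

Lemma smulMr n (f g : {mpoly R[n]}) : smul f -> smul (f * g).
Proof. by move=> sf; rewrite mulrC; apply: smulMl. Qed.

Lemma smulZ n c (f : {mpoly R[n]}) : smul f -> smul (c *: f).
Proof. by rewrite -mul_mpolyC; apply: smulMl. Qed.

Lemma smul_comp n k (f : {mpoly R[n]}) (psi : n.-tuple {mpoly R[k]}) :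
  smul f -> smul (f \mPo psi).
Proof. by move=> [v ->]; exists (v \mPo psi); rewrite comp_mpolyZ. Qed.

(** Congruence modulo s is compatible with sums, products and powers, hence with substitution into
    f. *)
Lemma smul_compB n k (f : {mpoly R[n]}) (phi psi : n.-tuple {mpoly R[k]}) :
  (forall i, smul (tnth phi i - tnth psi i)) -> smul ((f \mPo phi) - (f \mPo psi)).
Proof.
move=> sB; have mulB (a b c d : {mpoly R[k]}) : smul (a - b) -> smul (c - d) ->
    smul (a * c - b * d).
  move=> sab scd; rewrite (_ : _ - _ = a * (c - d) + (a - b) * d); last by ring.
  by apply: smulD; [apply: smulMl | apply: smulMr].
have expB i e : smul (tnth phi i ^+ e - tnth psi i ^+ e).
  elim: e => [|e IH]; first by rewrite !expr0 subrr; apply: smul0.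
  by rewrite !exprS; apply: mulB.
rewrite !comp_mpolyE -sumrB.
elim/big_rec: _ => [|m p _ sp]; first exact: smul0.
apply: smulD sp; rewrite -scalerBr; apply: smulZ.
by elim/big_rec2: _ => [|i a b _ sab]; rewrite ?subrr; [exact: smul0 | apply: mulB].
Qed.

(** If s is a zero divisor, the given cofactor may contain X_i in terms killed by s; setting X_i to
    0 removes them. *)
Lemma smul_free n (i : 'I_n) (f : {mpoly R[n]}) : free_of i f -> smul f ->
  exists2 v, free_of i v & f = s *: v.
Proof.
move=> fi [v fv]; exists (v \mPo zero_at R i); first exact: zero_at_free.
by rewrite -comp_mpolyZ -fv zero_at_id.
Qed.

Definition small_elementary n (phi : polymap R n) : Prop :=
  exists i f, [/\ free_of i f, smul f & phi = elem_map i f].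

(** Divisibility by s is a condition on each elementary factor and not only on the product. *)
Definition small_EA n : polymap R n -> Prop := words (@small_elementary n).

Definition stably_small_EA n (phi : polymap R n) : Prop :=
  exists2 N, (n <= N)%N & small_EA (stab N phi).

Lemma small_EA_elem n (i : 'I_n) f : free_of i f -> smul f -> small_EA (elem_map i f).
Proof. by move=> fi sf; apply: words_base; exists i, f. Qed.

Lemma small_elementary_stab n N (g : polymap R n) : (n <= N)%N ->
  small_elementary g -> small_elementary (stab N g).
Proof.
move=> nN [i [f [fi sf ->]]]; have iN := leq_trans (ltn_ord i) nN.
exists (Ordinal iN), (f \mPo emb n N); rewrite stab_elem.
by split=> //; [apply: free_of_emb | apply: smul_comp].
Qed.

Lemma small_EA_stab n N (g : polymap R n) : (n <= N)%N ->
  small_EA g -> small_EA (stab N g).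
Proof. by move=> nN; apply: stab_words => // h; apply: small_elementary_stab. Qed.

Lemma stably_small_EA_comp n (phi psi : polymap R n) :
  stably_small_EA phi -> stably_small_EA psi -> stably_small_EA (pm_comp phi psi).
Proof.
move=> [M nM tM] [N nN tN].
have nMN : (n <= maxn M N)%N by rewrite leq_max nM.
exists (maxn M N) => //; rewrite stab_comp //; apply: words_comp.
  by rewrite -(stab_stab _ nM) ?leq_maxl //; apply: small_EA_stab; rewrite ?leq_maxl.
by rewrite -(stab_stab _ nN) ?leq_maxr //; apply: small_EA_stab; rewrite ?leq_maxr.
Qed.

Lemma stably_small_EA_stab n N (phi : polymap R n) : (n <= N)%N ->
  stably_small_EA (stab N phi) -> stably_small_EA phi.
Proof.
move=> nN [M NM]; rewrite stab_stab // => sM.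
by exists M => //; apply: leq_trans NM.
Qed.

Lemma small_EA_stably n (phi : polymap R n) : small_EA phi -> stably_small_EA phi.
Proof. by exists n; rewrite ?stab_refl. Qed.

(** For j in r, [g j] involves no variable indexed by r, so the elementary factors do not disturb
    one another and can be composed one at a time. *)
Lemma small_EA_multi n (r : seq 'I_n) (g : 'I_n -> {mpoly R[n]}) : uniq r ->
  (forall i j, i \in r -> j \in r -> free_of i (g j)) ->
  (forall j, j \in r -> smul (g j)) ->
  small_EA [tuple if j \in r then 'X_j + g j else 'X_j | j < n].
Proof.
elim: r => [|i r IH] /=.
  move=> _ _ _; rewrite (_ : [tuple _ | j < n] = pm_id); first exact: words_id.
  by apply: eq_from_tnth => j; rewrite !tnth_mktuple.
move=> /andP[ir ur] fg sg.
set phi := [tuple _ | j < n].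
have -> : phi = pm_comp (elem_map i (g i)) [tuple if j \in r then 'X_j + g j else 'X_j | j < n].
  apply: eq_from_tnth => j; rewrite tnth_elem_mapC !tnth_mktuple inE.
  have [->|//] := eqVneq j i; rewrite (negbTE ir) /=; congr (_ + _).
  rewrite -[LHS]comp_mpoly_id; apply: eq_comp_mpoly => m k mg mk.
  rewrite !tnth_mktuple ifN //; apply: contraNN mk => kr.
  by apply/eqP/(fg k i) => //; rewrite inE ?kr ?eqxx ?orbT.
apply: words_cons.
  by exists i, (g i); split=> //; [apply: fg | apply: sg]; rewrite inE eqxx.
apply: IH => // [k j kr jr|j jr]; first by apply: fg; rewrite inE ?kr ?jr orbT.
by apply: sg; rewrite inE jr orbT.
Qed.

End ScalarMultiple.

Lemma pm_conjM (R : comNzRingType) n (g g' a b : polymap R n) : pm_comp g g' = pm_id ->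
  pm_comp (pm_comp g' (pm_comp a g)) (pm_comp g' (pm_comp b g)) =
  pm_comp g' (pm_comp (pm_comp a b) g).
Proof. by move=> gg'; rewrite !pm_compA -(pm_compA g) gg' pm_comp1p. Qed.

(** * Conjugation of a small elementary map by one tame generator *)

Section ConjugateByGenerator.
Variables (R : comNzRingType) (N : nat).
Implicit Types (i j : 'I_N) (s c : R) (g : polymap R N).

Let y : 'I_N.+1 := ord_max.
Let wi i : 'I_N.+1 := widen_ord (leqnSn N) i.

Let wi_y i : wi i == y = false.
Proof. by apply/negbTE; rewrite -val_eqE /= neq_ltn ltn_ord. Qed.

Let y_wi i : y == wi i = false.
Proof. by rewrite eq_sym wi_y. Qed.

Let wi_eq i j : (wi i == wi j) = (i == j).
Proof. by []. Qed.

Lemma tnth_stab_y (phi : polymap R N) : tnth (stab N.+1 phi) y = 'X_y.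
Proof. exact: tnth_stab_ge. Qed.

Lemma stab_elem_wi i (f : {mpoly R[N]}) :
  stab N.+1 (elem_map i f) = elem_map (wi i) (f \mPo emb N N.+1).
Proof.
by rewrite (stab_elem (leq_trans (ltn_ord i) (leqnSn N))); congr elem_map; apply: val_inj.
Qed.

Let wi_free j (u : {mpoly R[N]}) : free_of j u -> free_of (wi j) (u \mPo emb N N.+1).
Proof.
move/(free_of_emb (leq_trans (ltn_ord j) (leqnSn N))).
by rewrite (_ : Ordinal _ = wi j) //; apply: val_inj.
Qed.

Let newX_free i c : free_of (wi i) (c *: 'X_y : {mpoly R[N.+1]}).
Proof. by apply/free_ofZ/free_ofX; rewrite y_wi. Qed.

(** Write E for e_i(c y) and U for the image of u. If i = j the two maps commute; otherwise the
    conjugate is E o e_j(U - U o E), and E is congruent to the identity modulo s. *)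
Lemma conj_new_var_elem s i j u c : free_of j u -> smul s (c *: 'X_y : {mpoly R[N.+1]}) ->
  small_EA s (pm_comp (stab N.+1 (elem_map j (- u)))
    (pm_comp (elem_map (wi i) (c *: 'X_y)) (stab N.+1 (elem_map j u)))).
Proof.
move=> uj sc; rewrite !stab_elem_wi; set U := u \mPo emb N N.+1.
have -> : (- u) \mPo emb N N.+1 = - U by rewrite raddfN.
have Uj : free_of (wi j) U by apply: wi_free.
have [ij|ij] := eqVneq i j.
  rewrite -ij in Uj *; rewrite !elem_mapD //; last by apply: free_ofN.
  by rewrite addrC addrK; apply: small_EA_elem.
set E := elem_map (wi i) _.
have UE : U \mPo E = U \mPo pm_comp E (elem_map (wi j) U).
  apply: (free_of_comp_eq Uj) => k /negbTE kj.
  rewrite tnth_elem_mapC !tnth_elem_map kj.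
  have [_|//] := eqVneq k (wi i); rewrite wi_eq (negbTE ij).
  by rewrite comp_mpolyZ comp_mpolyXi tnth_elem_map y_wi.
pose w := U - (U \mPo E).
have -> : pm_comp (elem_map (wi j) (- U)) (pm_comp E (elem_map (wi j) U)) =
    pm_comp E (elem_map (wi j) w).
  apply: eq_from_tnth => k; rewrite tnth_elem_mapC.
  have [->|kj] := eqVneq k (wi j).
    rewrite !tnth_elem_mapC wi_eq eq_sym (negbTE ij) !tnth_elem_map !eqxx.
    by rewrite comp_mpolyN -UE addrA.
  rewrite !tnth_elem_mapC !tnth_elem_map (negbTE kj) !wi_eq (negbTE ij).
  by rewrite !comp_mpolyZ !comp_mpolyXi !tnth_elem_map y_wi.
apply: words_comp; apply: small_EA_elem => //.
  apply: free_ofD => //; apply/free_ofN/free_of_comp => m k mU mk.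
  have kj : k != wi j by apply: contraNneq mk => ->; apply/eqP/Uj.
  rewrite tnth_elem_map; case: ifP => _; last exact: free_ofX.
  by apply: free_ofD; [apply: free_ofX; rewrite wi_eq | apply: newX_free].
rewrite /w -[X in X - _]comp_mpoly_id; apply: smul_compB => k.
rewrite tnth_elem_map tnth_mktuple; case: eqP => [->|_]; last by rewrite subrr; apply: smul0.
by rewrite opprD addNKr; apply: smulN.
Qed.

(** If h is the inverse of the linear map g, then h(g + c y e_i) = X + c y h(e_i): a shift by
    multiples of c y, which involve no shifted variable. *)
Lemma conj_new_var_lin s i g g' c : GL g -> pm_inverse g g' ->
  smul s (c *: 'X_y : {mpoly R[N.+1]}) ->
  small_EA s (pm_comp (stab N.+1 g')
    (pm_comp (elem_map (wi i) (c *: 'X_y)) (stab N.+1 g))).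
Proof.
move=> gGL gg' sc.
have [h hGL gh] := GL_inverse gGL; rewrite (pm_inverse_uniq gg' gh) {g' gg'}.
have [B [B' [_ _ eB]]] := stab_GL (leqnSn N) hGL.
have [_ hg] := stab_inverse (leqnSn N) gh.
set G := stab _ g in hg *.
(* This is c y times column [wi i] of the matrix of the inverse. The index y is left out of [r]
   because g and its inverse fix that coordinate. *)
pose f k : {mpoly R[N.+1]} := B k (wi i) *: (c *: 'X_y).
pose r := [seq k <- enum 'I_N.+1 | k != y].
rewrite (_ : pm_comp _ _ = [tuple if k \in r then 'X_k + f k else 'X_k | k < N.+1]).
  apply: small_EA_multi => [||j jr].
  - by rewrite filter_uniq ?enum_uniq.
  - move=> k j; rewrite /r mem_filter => /andP[ky _] _.
    by do 2!apply: free_ofZ; apply: free_ofX; rewrite eq_sym.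
  by apply: smulZ.
apply: eq_from_tnth => k; rewrite [RHS]tnth_mktuple /r mem_filter mem_enum andbT.
rewrite tnth_pm_comp; have [->|ky] := eqVneq k y.
  by rewrite tnth_stab_y comp_mpolyXi tnth_elem_mapC y_wi tnth_stab_y.
have hgk : tnth (stab N.+1 h) k \mPo G = 'X_k by rewrite -tnth_pm_comp hg tnth_pm_id.
set EG := pm_comp _ G.
have tnthEG (j : 'I_N.+1) : tnth EG j = tnth G j + (if j == wi i then c *: 'X_y else 0).
  rewrite tnth_elem_mapC; have [->|_] := eqVneq j (wi i); last by rewrite addr0.
  by rewrite comp_mpolyZ comp_mpolyXi tnth_stab_y.
have lin (F : polymap R N.+1) :
    tnth (stab N.+1 h) k \mPo F = \sum_j B k j *: tnth F j.
  rewrite eB tnth_lin_map linear_sum; apply: eq_bigr => j _.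
  by rewrite [LHS]comp_mpolyZ comp_mpolyXi.
rewrite -hgk !lin.
under eq_bigr => j _ do rewrite tnthEG scalerDr.
rewrite big_split; congr (_ + _).
rewrite (bigD1 (wi i)) // eqxx big1; first exact: addr0.
by move=> j /negbTE ->; rewrite scaler0.
Qed.

Lemma conj_new_var s i g g' c : tame_gen g -> pm_inverse g g' ->
  smul s (c *: 'X_y : {mpoly R[N.+1]}) ->
  small_EA s (pm_comp (stab N.+1 g')
    (pm_comp (elem_map (wi i) (c *: 'X_y)) (stab N.+1 g))).
Proof.
case=> [gGL|[j [u [uj ->]]]] gg'; first exact: conj_new_var_lin.
rewrite -(pm_inverse_uniq (elem_map_inverse uj) gg').
exact: conj_new_var_elem.
Qed.

(** The two shifts of y cancel. X_i receives -s (y - s V) from the third factor, where y is already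
    shifted, and s y from the first; V itself never changes. *)
Lemma elem_map_commutator i (V : {mpoly R[N.+1]}) s :
    free_of (wi i) V -> free_of y V ->
  pm_comp (elem_map (wi i) (s *: 'X_y)) (pm_comp (elem_map y (s *: V))
    (pm_comp (elem_map (wi i) (- s *: 'X_y)) (elem_map y (- (s *: V))))) =
  elem_map (wi i) ((s * s) *: V).
Proof.
move=> Vi Vy; set w := pm_comp (elem_map (wi i) _) (elem_map y _).
have Vw : V \mPo w = V.
  rewrite -[RHS]comp_mpoly_id; apply: eq_comp_mpoly => m k mV mk.
  have ki : k == wi i = false by apply: contraNF mk => /eqP->; apply/eqP/Vi.
  have ky : k == y = false by apply: contraNF mk => /eqP->; apply/eqP/Vy.
  by rewrite tnth_elem_mapC !tnth_elem_map tnth_mktuple ki ky.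
apply: eq_from_tnth => k; rewrite tnth_elem_mapC tnth_elem_map.
have [_|ki] := eqVneq k (wi i).
  rewrite tnth_elem_mapC wi_y comp_mpolyZ comp_mpolyXi tnth_elem_mapC eqxx.
  rewrite comp_mpolyZ Vw !tnth_elem_mapC !eqxx y_wi !tnth_elem_map wi_y eqxx.
  rewrite comp_mpolyZ comp_mpolyXi tnth_elem_map eqxx -!mul_mpolyC rmorphM rmorphN.
  by ring.
rewrite tnth_elem_mapC comp_mpolyZ Vw !tnth_elem_mapC !tnth_elem_map (negbTE ki) y_wi eqxx.
by have [->|] := eqVneq k y; rewrite ?subrK.
Qed.

(* With a new variable y, e_i(s^2 v) is the commutator of e_i(s y) and e_y(s v);
   conjugating e_y(s v) by [g] only substitutes [g] into v, and conjugating
   e_i(s y) by [g] is explicit for a generator [g]. *)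
Lemma conj_small_elementary s g g' (phi : polymap R N) :
    tame_gen g -> pm_inverse g g' -> small_elementary (s * s) phi ->
  small_EA s (stab N.+1 (pm_comp g' (pm_comp phi g))).
Proof.
move=> tg gg' [i [f [fi sf ->]]].
have [v vi fv] := smul_free fi sf.
set V := v \mPo emb N N.+1.
have Vi : free_of (wi i) V by apply: wi_free.
have Vy : free_of y V by apply: free_of_emb_new.
have Vgy : free_of y ((v \mPo g) \mPo emb N N.+1) by apply: free_of_emb_new.
set W := s *: ((v \mPo g) \mPo emb N N.+1).
have Wy : free_of y W by apply: free_ofZ.
have sW : smul s W by exists ((v \mPo g) \mPo emb N N.+1).
set G := stab N.+1 g; set G' := stab N.+1 g'.
have [GG' G'G] : pm_inverse G G' by apply: stab_inverse.
have VG : V \mPo G = (v \mPo g) \mPo emb N N.+1.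
  by rewrite [LHS]comp_mpolyA (emb_stab _ (leqnSn N)) -comp_mpolyA.
(* G fixes y and turns V into V o G, so e_y of a multiple of s V can be moved across G. The scalar e
   is used at 1 and at -1, for the two shifts of y. *)
have GW (e : R) : pm_comp G (elem_map y (e *: W)) = pm_comp (elem_map y (e *: (s *: V))) G.
  apply: eq_from_tnth => k; rewrite tnth_elem_mapC.
  have [->|ky] := eqVneq k y.
    rewrite tnth_pm_comp tnth_stab_y comp_mpolyXi tnth_elem_map eqxx; congr (_ + _).
    by rewrite !comp_mpolyZ VG.
  have kN : (k < N)%N by rewrite ltn_neqAle -ltnS ltn_ord andbT -[N]/(val y) val_eqE.
  rewrite tnth_pm_comp (tnth_stab_lt _ kN) comp_mpolyA; congr (_ \mPo _).
  apply: eq_from_tnth => l; rewrite tnth_mcomp.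
  have -> : tnth (@emb R N N.+1) l = 'X_(wi l) by rewrite tnth_emb -(var_or_0E R (wi l)).
  by rewrite comp_mpolyXi tnth_elem_map wi_y.
have GW1 : elem_map y W = pm_comp G' (pm_comp (elem_map y (s *: V)) G).
  by rewrite -[s *: V]scale1r -GW scale1r -pm_compA G'G pm_comp1p.
have GWN : elem_map y (- W) = pm_comp G' (pm_comp (elem_map y (- (s *: V))) G).
  by rewrite -[- (s *: V)]scaleN1r -GW scaleN1r -pm_compA G'G pm_comp1p.
have stabE : stab N.+1 (pm_comp g' (pm_comp (elem_map i f) g)) =
    pm_comp G' (pm_comp (elem_map (wi i) ((s * s) *: V)) G).
  by rewrite !(stab_comp _ _ (leqnSn N)) stab_elem_wi fv comp_mpolyZ; apply: erefl.
have sy e : smul s (e *: 'X_y : {mpoly R[N.+1]}) ->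
    small_EA s (pm_comp G' (pm_comp (elem_map (wi i) (e *: 'X_y)) G)).
  exact: conj_new_var.
rewrite stabE.
clearbody V W G G'.
rewrite -(elem_map_commutator s Vi Vy) -!(pm_conjM _ _ GG') -GW1 -GWN.
apply: words_comp; first by apply: sy; exists 'X_y.
apply: words_comp; first exact: small_EA_elem.
apply: words_comp; first by apply: sy; exists (- 'X_y); rewrite scaleNr scalerN.
by apply: small_EA_elem; [apply: free_ofN | apply: smulN].
Qed.

End ConjugateByGenerator.

Lemma conj_small_EA_gen (R : comNzRingType) N s (g g' w : polymap R N) :
    tame_gen g -> pm_inverse g g' -> small_EA (s * s) w ->
  stably_small_EA s (pm_comp g' (pm_comp w g)).
Proof.
move=> tg gg'; elim=> [|h {}w sh _ IH].
  by rewrite pm_comp1p; case: gg' => _ ->; apply/small_EA_stably/words_id.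
have -> : pm_comp g' (pm_comp (pm_comp h w) g) =
    pm_comp (pm_comp g' (pm_comp h g)) (pm_comp g' (pm_comp w g)).
  by rewrite !pm_compA -(pm_compA g g'); case: gg' => -> _; rewrite pm_comp1p.
apply: stably_small_EA_comp IH; exists N.+1 => //.
exact: conj_small_elementary sh.
Qed.

Lemma conj_small_EA (R : comNzRingType) n (alpha alpha' : polymap R n) s l :
    TA alpha -> pm_inverse alpha alpha' ->
  exists k, forall N (w : polymap R N), (n <= N)%N -> small_EA (s ^+ k) w ->
    stably_small_EA (s ^+ l) (pm_comp (stab N alpha') (pm_comp w (stab N alpha))).
Proof.
rewrite TA_words => wa; elim: wa alpha' => [|g v tg tv IH] alpha' aK.
  rewrite -(pm_inverse_uniq (pm_inverse_id R n) aK); exists l => N w nN sw.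
  by rewrite !stab1 pm_comp1p pm_compp1; apply: small_EA_stably.
have [v' _ vK] := words_inverse (@tame_gen_inverse R n) tv.
have [g' _ gK] := tame_gen_inverse tg.
rewrite -(pm_inverse_uniq (pm_inverse_comp gK vK) aK).
(* For alpha = g o v, conjugation by g comes first and halves the exponent from k + k to k.
   Conjugation by v then goes by induction, but in M variables, which is why the claim quantifies
   over N. *)
have [k kP] := IH _ vK; exists (k + k)%N => N w nN; rewrite exprD => sw.
have [M NM sM] := conj_small_EA_gen (stab_tame_gen nN tg) (stab_inverse nN gK) sw.
apply: (stably_small_EA_stab NM); move: {sM} (kP M _ (leq_trans nN NM) sM).
rewrite -(stab_stab v nN NM) -(stab_stab v' nN NM) -!(stab_comp _ _ NM).
rewrite !(stab_comp _ _ nN).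
move: (stab N v) (stab N v') (stab N g) (stab N g') => a a' b b'.
by rewrite !pm_compA.
Qed.

(** * Difference quotients *)

Section DiffQuot.
Variables (R : comNzRingType) (n : nat).
Implicit Types (c : 'I_n -> R) (t : R) (f g : {mpoly R[n]}) (phi psi : polymap R n).

(* [dquot c t f] is (f(c + t X) - f(c)) / t, which makes sense for every t. *)
Definition lower t f : {mpoly R[n]} :=
  \sum_(m <- msupp f | m != 0%MM) (f@_m * t ^+ (mdeg m).-1) *: 'X_[m].

Definition dquot c t f : {mpoly R[n]} :=
  lower t (f \mPo [tuple 'X_i + (c i)%:MP | i < n]).

Definition pm_dquot c t phi : polymap R n := [tuple dquot c t (tnth phi i) | i < n].

Lemma tnth_pm_dquot c t phi i : tnth (pm_dquot c t phi) i = dquot c t (tnth phi i).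
Proof. exact: tnth_mktuple. Qed.

Lemma mcoeff_lower t f m :
  (lower t f)@_m = if m == 0%MM then 0 else f@_m * t ^+ (mdeg m).-1.
Proof.
rewrite raddf_sum /=; case: eqP => [->|/eqP m0].
  by rewrite big1 // => m' /negbTE m'0; rewrite mcoeffZ mcoeffX m'0 mulr0.
have [mf|mf] := boolP (m \in msupp f).
  rewrite big_mkcond (bigD1_seq m) //= m0 mcoeffZ mcoeffX eqxx mulr1 big1 ?addr0 //.
  by move=> m' /negbTE m'm; rewrite mcoeffZ mcoeffX m'm mulr0 if_same.
rewrite (memN_msupp_eq0 mf) mul0r big_seq_cond big1 // => m' /andP[m'f _].
rewrite mcoeffZ mcoeffX; case: eqP => [e|_]; last by rewrite mulr0.
by rewrite -e m'f in mf.
Qed.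

Lemma lower_is_linear t a f g : lower t (a *: f + g) = a *: lower t f + lower t g.
Proof.
apply/mpolyP => m; rewrite mcoeffD mcoeffZ !mcoeff_lower mcoeffD mcoeffZ.
by case: eqP => _; rewrite ?mulr0 ?addr0 // mulrDl mulrA.
Qed.

Lemma dquot_is_linear c t a f g : dquot c t (a *: f + g) = a *: dquot c t f + dquot c t g.
Proof. by rewrite /dquot comp_mpolyD comp_mpolyZ lower_is_linear. Qed.

Lemma dquotD c t f g : dquot c t (f + g) = dquot c t f + dquot c t g.
Proof. by rewrite -[f]scale1r dquot_is_linear !scale1r. Qed.

Lemma dquot0 c t : dquot c t 0 = 0.
Proof. by apply: (addrI (dquot c t 0)); rewrite -dquotD !addr0. Qed.

Lemma dquotZ c t a f : dquot c t (a *: f) = a *: dquot c t f.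
Proof. by rewrite -[a *: f]addr0 dquot_is_linear dquot0 addr0. Qed.

Lemma dquot_sum c t (I : Type) (r : seq I) (F : I -> {mpoly R[n]}) :
  dquot c t (\sum_(i <- r) F i) = \sum_(i <- r) dquot c t (F i).
Proof. by elim: r => [|i r IH]; rewrite ?big_nil ?dquot0 // !big_cons dquotD IH. Qed.

Lemma dquotX c t i : dquot c t 'X_i = 'X_i.
Proof.
rewrite /dquot comp_mpolyXi tnth_mktuple; apply/mpolyP => m.
rewrite mcoeff_lower mcoeffD mcoeffC mcoeffX.
have [->|_] := eqVneq m 0%MM; first by rewrite mnm1_eq0.
rewrite mulr0 addr0; have [<-|_] := eqVneq; last by rewrite mul0r.
by rewrite mdeg1 expr0 mulr1.
Qed.

Lemma free_of_dquot c t i f : free_of i f -> free_of i (dquot c t f).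
Proof.
move=> fi; have gi : free_of i (f \mPo [tuple 'X_j + (c j)%:MP | j < n]).
  apply: free_of_comp => m j mf mj; rewrite tnth_mktuple.
  apply: free_ofD; last exact: free_ofC.
  by apply: free_ofX; apply: contraNneq mj => ->; apply/eqP/fi.
move=> m; rewrite mcoeff_msupp mcoeff_lower => am; apply: gi.
rewrite mcoeff_msupp; apply: contraNneq am => ->.
by rewrite mul0r if_same.
Qed.

Lemma pm_dquot1 c t : pm_dquot c t pm_id = pm_id.
Proof. by apply: eq_from_tnth => i; rewrite tnth_pm_dquot !tnth_pm_id dquotX. Qed.

Lemma pm_dquot_lin c t (A : 'M[R]_n) : pm_dquot c t (lin_map A) = lin_map A.
Proof.
apply: eq_from_tnth => i; rewrite tnth_pm_dquot !tnth_lin_map dquot_sum.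
by apply: eq_bigr => j _; rewrite dquotZ dquotX.
Qed.

Lemma pm_dquot_elem c t i f : pm_dquot c t (elem_map i f) = elem_map i (dquot c t f).
Proof.
apply: eq_from_tnth => j; rewrite tnth_pm_dquot !tnth_elem_map.
by case: ifP => _; rewrite ?dquotD dquotX.
Qed.

Lemma pm_dquot_tame_gen c t phi : tame_gen phi -> tame_gen (pm_dquot c t phi).
Proof.
case=> [[A [B [AB BA ->]]]|[i [f [fi ->]]]].
  by left; exists A, B; rewrite pm_dquot_lin.
right; exists i, (dquot c t f); rewrite pm_dquot_elem.
by split=> //; apply: free_of_dquot.
Qed.

Definition scaling c t : n.-tuple {mpoly R[n]} := [tuple t *: 'X_i + (c i)%:MP | i < n].

Definition pm_eval phi c : 'I_n -> R := fun i => (tnth phi i).@[c].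

Lemma mcoeff0_translate c f : (f \mPo [tuple 'X_i + (c i)%:MP | i < n])@_0%MM = f.@[c].
Proof.
set q := [tuple _ | i < n].
pose g : {rmorphism {mpoly R[n]} -> R} := mcoeff 0%MM \o comp_mpoly q.
apply: (@mpoly_rmorph_ext _ _ _ g (meval c)) => [a|i] /=.
  by rewrite comp_mpolyC mevalC mcoeffC eqxx mulr1.
rewrite comp_mpolyXi tnth_mktuple mevalXU mcoeffD mcoeffX mcoeffC eqxx mulr1.
by rewrite mnm1_eq0 add0r.
Qed.

Lemma scale_lower t f :
  t *: lower t f = (f \mPo [tuple t *: 'X_i | i < n]) - (f@_0%MM)%:MP.
Proof.
have -> : f \mPo [tuple t *: 'X_i | i < n] =
    \sum_(m <- msupp f) (f@_m * t ^+ mdeg m) *: 'X_[m].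
  rewrite comp_mpolyE; apply: eq_bigr => m _.
  under eq_bigr => i _ do rewrite tnth_mktuple exprZn.
  by rewrite scaler_prod -mpolyXE_id scalerA prodrXr -mdegE.
apply/mpolyP => m; rewrite mcoeffZ mcoeff_lower mcoeffB mcoeffC raddf_sum /=.
have -> : \sum_(m' <- msupp f) ((f@_m' * t ^+ mdeg m') *: 'X_[m'])@_m = f@_m * t ^+ mdeg m.
  have [mf|mf] := boolP (m \in msupp f).
    rewrite (bigD1_seq m) //= mcoeffZ mcoeffX eqxx mulr1 big1 ?addr0 //.
    by move=> m' /negbTE m'm; rewrite mcoeffZ mcoeffX m'm mulr0.
  rewrite (memN_msupp_eq0 mf) mul0r big_seq big1 // => m' m'f.
  rewrite mcoeffZ mcoeffX; case: eqP => [e|_]; last by rewrite mulr0.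
  by rewrite -e m'f in mf.
case: eqP => [->|/eqP m0]; first by rewrite mdeg0 expr0 !mulr1 mulr0 subrr.
rewrite mulr0 subr0 mulrCA -exprS prednK // lt0n mdeg_eq0 //.
Qed.

(** This equation determines [dquot c t f] when multiplication by t is injective; the chain rule is
    first proved in that case. *)
Lemma scale_dquot c t f : t *: dquot c t f = (f \mPo scaling c t) - (f.@[c])%:MP.
Proof.
rewrite /dquot scale_lower mcoeff0_translate comp_mpolyA.
suff -> : mcomp [tuple 'X_i + (c i)%:MP | i < n] [tuple t *: 'X_i | i < n] = scaling c t by [].
apply: eq_from_tnth => i.
by rewrite tnth_mcomp !tnth_mktuple comp_mpolyD comp_mpolyXi comp_mpolyC tnth_mktuple.
Qed.

(** The coefficients of [dquot c t f] are polynomials in t, and t + s u is congruent to t modulo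
    s. *)
Lemma smul_dquotB c t s u f : smul s (dquot c (t + s * u) f - dquot c t f).
Proof.
have powB k : exists d, (t + s * u) ^+ k = t ^+ k + s * d.
  elim: k => [|k [d IH]]; first by exists 0; rewrite !expr0 mulr0 addr0.
  by exists (u * t ^+ k + (t + s * u) * d); rewrite !exprS IH; ring.
rewrite /dquot; move: (f \mPo _) => g.
rewrite /lower -sumrB; elim/big_rec: _ => [|m h _]; first exact: smul0.
apply: smulD; rewrite -scalerBl; have [d ->] := powB (mdeg m).-1.
by rewrite mulrDr addrC addKr mulrCA -scalerA; exists ((g@_m * d) *: 'X_[m]).
Qed.

(** By 0^0 = 1, the factor t^(d-1) on terms of degree d keeps, at t = 0, exactly those with d = 1.
    The result is the differential of phi at c. *)
Lemma pm_dquot_at0 c phi : exists A, pm_dquot c 0 phi = lin_map A.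
Proof.
exists (\matrix_(i, j) (dquot c 0 (tnth phi i))@_(U_(j))).
apply: eq_from_tnth => i; rewrite tnth_pm_dquot tnth_lin_map /dquot.
under eq_bigr => j _ do rewrite mxE.
rewrite /dquot; move: (_ \mPo _) => g; apply/mpolyP => m.
rewrite [in RHS]raddf_sum /=; have [/mdeg1P[j /eqP->]|m1] := boolP (mdeg m == 1%N).
  rewrite [RHS](bigD1 j) //= mcoeffZ mcoeffX eqxx mulr1 big1 ?addr0 //.
  by move=> k kj; rewrite mcoeffZ mcoeffX eq_mnm1 (negbTE kj) mulr0.
rewrite mcoeff_lower big1; last first.
  move=> j _; rewrite mcoeffZ mcoeffX.
  have [e|_] := eqVneq U_(j)%MM m; last by rewrite mulr0.
  by rewrite -e mdeg1 in m1.
case: eqP => // /eqP; rewrite -mdeg_eq0.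
by case: (mdeg m) m1 => [|[|k]] //= _ _; rewrite exprS mul0r mulr0.
Qed.

End DiffQuot.

Lemma map_dquot (R S : comNzRingType) (h : {rmorphism R -> S}) n c t (f : {mpoly R[n]}) :
  map_mpoly h (dquot c t f) = dquot (h \o c) (h t) (map_mpoly h f).
Proof.
rewrite /dquot; have -> : map_mpoly h f \mPo [tuple 'X_i + ((h \o c) i)%:MP | i < n] =
    map_mpoly h (f \mPo [tuple 'X_i + (c i)%:MP | i < n]).
  rewrite map_mpoly_comp; congr (_ \mPo _); apply: eq_from_tnth => i.
  by rewrite !tnth_mktuple rmorphD /= map_mpolyXi map_mpolyC.
move: (_ \mPo _) => g; apply/mpolyP => m; rewrite mcoeff_map !mcoeff_lower.
by case: eqP => _; rewrite ?rmorph0 // rmorphM rmorphXn mcoeff_map.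
Qed.

Lemma map_pm_dquot (R S : comNzRingType) (h : {rmorphism R -> S}) n c t (phi : polymap R n) :
  pm_map h (pm_dquot c t phi) = pm_dquot (h \o c) (h t) (pm_map h phi).
Proof.
by apply: eq_from_tnth => i; rewrite tnth_pm_map !tnth_pm_dquot map_dquot tnth_pm_map.
Qed.

Lemma eq_pm_dquot (R : comNzRingType) n c c' t (phi : polymap R n) :
  c =1 c' -> pm_dquot c t phi = pm_dquot c' t phi.
Proof. by move/funext->. Qed.

Lemma map_meval (R S : comNzRingType) (h : {rmorphism R -> S}) n c (f : {mpoly R[n]}) :
  h f.@[c] = (map_mpoly h f).@[h \o c].
Proof.
pose g1 : {rmorphism {mpoly R[n]} -> S} := h \o meval c.
pose g2 : {rmorphism {mpoly R[n]} -> S} := meval (h \o c) \o map_mpoly h.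
apply: (@mpoly_rmorph_ext _ _ _ g1 g2) => [a|i] /=; first by rewrite map_mpolyC !mevalC.
by rewrite map_mpolyXi !mevalXU.
Qed.

Lemma map_pm_eval (R S : comNzRingType) (h : {rmorphism R -> S}) n c (phi : polymap R n) :
  h \o pm_eval phi c = pm_eval (pm_map h phi) (h \o c).
Proof. by apply: funext => i; rewrite /= map_meval /pm_eval tnth_pm_map. Qed.

Lemma pm_dquot_comp_regular (R : comNzRingType) n c t (phi psi : polymap R n) :
    (forall x, t * x = 0 -> x = 0) ->
  pm_dquot c t (pm_comp phi psi) =
  pm_comp (pm_dquot (pm_eval psi c) t phi) (pm_dquot c t psi).
Proof.
move=> reg_t.
have gs : mcomp psi (scaling c t) = mcomp (scaling (pm_eval psi c) t) (pm_dquot c t psi).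
  apply: eq_from_tnth => j; rewrite !tnth_mcomp !tnth_mktuple.
  rewrite comp_mpolyD comp_mpolyZ comp_mpolyC comp_mpolyXi tnth_pm_dquot scale_dquot.
  by rewrite subrK.
apply: eq_from_tnth => i.
apply/subr0_eq/mpolyP => m; rewrite mcoeff0; apply: reg_t.
rewrite -mcoeffZ scalerBr tnth_pm_dquot !tnth_pm_comp tnth_pm_dquot.
move: (tnth phi i) => f.
have -> : t *: dquot c t (f \mPo psi) =
    t *: (dquot (pm_eval psi c) t f \mPo pm_dquot c t psi).
  rewrite scale_dquot -[in RHS]comp_mpolyZ scale_dquot comp_mpolyB comp_mpolyC comp_mpoly_meval.
  by rewrite !(comp_mpolyA f) gs.
by rewrite subrr mcoeff0.
Qed.

Opaque pm_dquot dquot lower pm_map.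

(** To be used with A = R[T], where T is regular, and h the evaluation at T = t: the regular case
    applies in A, and h brings the identity back to R. *)
Lemma pm_dquot_comp_retract (R A : comNzRingType) (C : {rmorphism R -> A})
    (h : {rmorphism A -> R}) (T : A) n c t (phi psi : polymap R n) :
    (forall x, h (C x) = x) -> h T = t -> (forall x, T * x = 0 -> x = 0) ->
  pm_dquot c t (pm_comp phi psi) =
  pm_comp (pm_dquot (pm_eval psi c) t phi) (pm_dquot c t psi).
Proof.
move=> hC hT regT.
have dquotC e (f : polymap R n) : pm_map h (pm_dquot (C \o e) T (pm_map C f)) = pm_dquot e t f.
  have hCid : h \o C =1 id by move=> x; apply: hC.
  rewrite (map_pm_dquot h) hT pm_mapM (pm_map_id _ hCid); apply: eq_pm_dquot => i.
  exact: hC.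
have := pm_dquot_comp_regular (C \o c) (pm_map C phi) (pm_map C psi) regT.
rewrite -(pm_map_comp C phi psi) -(map_pm_eval C c psi).
move=> E; rewrite -(dquotC c (pm_comp phi psi)) -(dquotC c psi) -(dquotC (pm_eval psi c) phi).
by rewrite -(pm_map_comp h) E.
Qed.

(* The chain rule holds after multiplication by t, hence over R[t] where t is
   regular, hence for all t by specialization. *)
Lemma pm_dquot_comp (R : comNzRingType) n c t (phi psi : polymap R n) :
  pm_dquot c t (pm_comp phi psi) =
  pm_comp (pm_dquot (pm_eval psi c) t phi) (pm_dquot c t psi).
Proof.
apply: (@pm_dquot_comp_retract R {poly R} polyC (horner_eval t) 'X) => [x||x Xx].
- exact: hornerC.
- exact: hornerX.
by apply/polyP => i; have := coefXM x i.+1; rewrite Xx !coef0.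
Qed.

Lemma pm_dquot_inverse (R : comNzRingType) n c t (phi psi : polymap R n) :
  pm_inverse phi psi -> pm_inverse (pm_dquot c t phi) (pm_dquot (pm_eval phi c) t psi).
Proof.
move=> [e1 e2]; split; last by rewrite -pm_dquot_comp e2 pm_dquot1.
(* For phi o psi the chain rule starts from the point phi(c), and psi takes phi(c) back to c. *)
have {1}-> : c = pm_eval psi (pm_eval phi c).
  apply: funext => i; rewrite /pm_eval -comp_mpoly_meval -tnth_pm_comp e2 tnth_pm_id.
  by rewrite mevalXU.
by rewrite -pm_dquot_comp e1 pm_dquot1.
Qed.

Opaque pm_eval.

(** * Difference quotients of a tame map at nearby points *)

(** Before conjugation the map is the identity for g linear, and e_i of a multiple of s^k for g
    elementary; k is what conjugation by beta costs in [conj_small_EA]. *)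
Lemma gen_dquot_step (R : comNzRingType) n (s t : R) c (g beta beta' : polymap R n) :
    tame_gen g -> TA beta -> pm_inverse beta beta' ->
  exists k, forall u delta, pm_inverse (pm_dquot c t g) delta ->
    stably_small_EA s
      (pm_comp beta' (pm_comp (pm_comp delta (pm_dquot c (t + s ^+ k * u) g)) beta)).
Proof.
move=> tg tbeta betaK; have [k kP] := conj_small_EA s 1 tbeta betaK.
exists k => u delta gK.
have := kP n (pm_comp delta (pm_dquot c (t + s ^+ k * u) g)) (leqnn n).
rewrite !stab_refl expr1; apply; case: tg gK => [[A [B [AB BA ->]]]|[i [f [fi ->]]]].
  by rewrite !pm_dquot_lin => -[_ ->]; apply: words_id.
rewrite !pm_dquot_elem => gK; have fti : free_of i (dquot c t f) by apply: free_of_dquot.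
rewrite -(pm_inverse_uniq (elem_map_inverse fti) gK) elem_mapD; last exact: free_ofN.
rewrite addrC; apply: small_EA_elem; last exact: smul_dquotB.
by apply: free_ofD; [apply: free_of_dquot | apply: free_ofN].
Qed.

Lemma TA_pm_dquot (R : comNzRingType) n (t : R) c (phi : polymap R n) :
  TA phi -> TA (pm_dquot c t phi).
Proof.
rewrite !TA_words => tphi; elim: tphi c => [|g w tg tw IH] c.
  by rewrite pm_dquot1; apply: words_id.
by rewrite pm_dquot_comp; apply: words_cons; [apply: pm_dquot_tame_gen | apply: IH].
Qed.

Lemma TA_GA (R : comNzRingType) n (phi : polymap R n) :
  TA phi -> exists psi, pm_inverse phi psi.
Proof.
by rewrite TA_words => /(words_inverse (@tame_gen_inverse R n))[psi _ ?]; exists psi.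
Qed.

(** The step for a word g o w is the step for g, conjugated by w_t o alpha, times the step for w,
    conjugated by alpha. Here a, w and w2 stand for alpha, w_t and w_(t + s^k u). *)
Lemma monoid_telescope (T : Type) (e : T) (op : T -> T -> T) (a a' w w' g' w2 g2 : T) :
    (forall x y z, op (op x y) z = op x (op y z)) -> (forall x, op e x = x) ->
    op a a' = e -> op w w' = e ->
  op (op (op a' w') (op (op g' g2) (op w a))) (op a' (op (op w' w2) a)) =
  op a' (op (op (op w' g') (op g2 w2)) a).
Proof.
move=> opA op1 aK wK; rewrite !opA -(opA a a') aK op1.
by rewrite -(opA w w') wK op1.
Qed.

Lemma TA_dquot_step_conj (R : comNzRingType) n (s t : R) c (phi alpha alpha' : polymap R n) :
    TA phi -> TA alpha -> pm_inverse alpha alpha' ->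
  exists k, forall u delta, pm_inverse (pm_dquot c t phi) delta ->
    stably_small_EA s
      (pm_comp alpha' (pm_comp (pm_comp delta (pm_dquot c (t + s ^+ k * u) phi)) alpha)).
Proof.
rewrite TA_words => wphi talpha alphaK; elim: wphi c => [|g w tg tw IH] c.
  exists 0%N => u delta; rewrite !pm_dquot1 pm_compp1 => -[+ _].
  rewrite pm_comp1p => ->; rewrite pm_comp1p; case: alphaK => _ ->.
  exact/small_EA_stably/words_id.
have {IH} [k2 IH] := IH c.
have tw' : TA (pm_dquot c t w) by apply/TA_pm_dquot/TA_words.
have [w' wK] := TA_GA tw'.
(* In the chain rule g is taken at the point w(c), which is the same for t and for the displaced
   parameter. *)
have [k1 gP] := gen_dquot_step s t (pm_eval w c) tg (gen_comp tw' talpha)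
  (pm_inverse_comp wK alphaK).
(* s^(k1 + k2) u is both s^k1 (s^k2 u) and s^k2 (s^k1 u), so each of the two steps absorbs the
   surplus power into u. *)
exists (k1 + k2)%N => u delta.
rewrite !pm_dquot_comp => dK.
have [g' gK] : exists g', pm_inverse (pm_dquot (pm_eval w c) t g) g'.
  by have [h _ ?] := tame_gen_inverse (pm_dquot_tame_gen (pm_eval w c) t tg); exists h.
rewrite -(pm_inverse_uniq (pm_inverse_comp gK wK) dK).
have := gP (s ^+ k2 * u) g' gK; rewrite mulrA -exprD => /stably_small_EA_comp gP'.
have := IH (s ^+ k1 * u) w' wK; rewrite mulrA -exprD addnC => /gP' {gP IH gP'}.
case: wK alphaK => wK _ [alphaK _].
set b := pm_dquot c (t + s ^+ _ * u) w; set d := pm_dquot _ _ g.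
move=> H; have E := monoid_telescope g' b d (@pm_compA R n) (@pm_comp1p R n) alphaK wK.
refine (eq_ind _ (@stably_small_EA R s n) _ _ E).
exact: H.
Qed.

Theorem TA_dquot_step (R : comNzRingType) n (s t : R) c (phi delta : polymap R n) :
    TA phi -> pm_inverse (pm_dquot c t phi) delta ->
  exists k, forall u,
    stably_small_EA s (pm_comp delta (pm_dquot c (t + s ^+ k * u) phi)).
Proof.
move=> tphi dK.
have [k kP] := TA_dquot_step_conj s t c tphi (gen_id _) (pm_inverse_id R n).
by exists k => u; have := kP u _ dK; rewrite pm_comp1p pm_compp1.
Qed.

(** * Denominators and descent *)

(** Choices are kept only at the finitely many monomials of the support; [Q 0 0] settles all
    others. *)
Lemma mpoly_choose (R K : comNzRingType) n (f : {mpoly K[n]}) (Q : K -> R -> Prop) :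
    Q 0 0 -> (forall m, exists a, Q f@_m a) ->
  exists g : {mpoly R[n]}, forall m, Q f@_m g@_m.
Proof.
move=> Q0 /choice[F FP]; exists (\sum_(m <- msupp f) F m *: 'X_[m]) => m.
rewrite raddf_sum /=; have [mf|mf] := boolP (m \in msupp f).
  rewrite (bigD1_seq m) //= mcoeffZ mcoeffX eqxx mulr1 big1 ?addr0 //.
  by move=> m' /negbTE m'm; rewrite mcoeffZ mcoeffX m'm mulr0.
rewrite (memN_msupp_eq0 mf) big_seq big1 // => m' m'f.
rewrite mcoeffZ mcoeffX; have [e|_] := eqVneq m' m; last by rewrite mulr0.
by rewrite -e m'f in mf.
Qed.

Section Fractions.
Variables (R K : comNzRingType) (h : {rmorphism R -> K}) (D : R -> Prop).

(* K is a localization of R at D, except that h(d) need not be invertible. *)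
Record fractions : Prop := Fractions {
  frac1 : D 1;
  fracM : forall a b, D a -> D b -> D (a * b);
  frac_kill : forall a, h a = 0 -> exists2 d, D d & d * a = 0;
  frac_clear : forall k, exists2 d, D d & exists a, h d * k = h a }.

Hypothesis frK : fractions.

Lemma frac_kill_seq (s : seq R) : (forall a, a \in s -> h a = 0) ->
  exists2 d, D d & forall a, a \in s -> d * a = 0.
Proof.
elim: s => [|b s IH] hs; first by exists 1 => //; apply: frac1.
have [|d Dd ds] := IH; first by move=> a sa; apply: hs; rewrite inE sa orbT.
have [|e De eb] := frac_kill frK (a := b); first by apply: hs; rewrite inE eqxx.
exists (d * e); first exact: fracM.
move=> a; rewrite inE => /orP[/eqP->|/ds da]; first by rewrite -mulrA eb mulr0.
by rewrite mulrAC da mul0r.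
Qed.

Lemma frac_clear_seq (s : seq K) :
  exists2 d, D d & forall k, k \in s -> exists a, h d * k = h a.
Proof.
elim: s => [|b s [d Dd ds]]; first by exists 1 => //; apply: frac1.
have [e De [a eb]] := frac_clear frK b.
exists (d * e); first exact: fracM.
move=> k; rewrite inE => /orP[/eqP->|/ds[a' da']].
  by exists (d * a); rewrite !rmorphM -mulrA eb.
by exists (a' * e); rewrite !rmorphM mulrAC da'.
Qed.

Lemma frac_kill_mpoly n (f : {mpoly R[n]}) :
  map_mpoly h f = 0 -> exists2 d, D d & d *: f = 0.
Proof.
move=> hf; have [|d Dd dP] := @frac_kill_seq [seq f@_m | m <- msupp f].
  by move=> _ /mapP[m _ ->]; rewrite -mcoeff_map hf mcoeff0.
exists d => //; apply/mpolyP => m; rewrite mcoeffZ mcoeff0.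
have [mf|/memN_msupp_eq0->] := boolP (m \in msupp f); last by rewrite mulr0.
exact/dP/map_f.
Qed.

Lemma frac_clear_mpoly n (f : {mpoly K[n]}) :
  exists2 d, D d & exists g, h d *: f = map_mpoly h g.
Proof.
have [d Dd dP] := @frac_clear_seq [seq f@_m | m <- msupp f].
exists d => //; have [||g gP] := @mpoly_choose R K n f (fun k a => h d * k = h a).
- by rewrite mulr0 rmorph0.
- move=> m; have [mf|/memN_msupp_eq0->] := boolP (m \in msupp f); last first.
    by exists 0; rewrite mulr0 rmorph0.
  exact/dP/map_f.
by exists g; apply/mpolyP => m; rewrite mcoeffZ mcoeff_map gP.
Qed.

End Fractions.

(** * Evaluation and dilation of an indeterminate *)

Section Dilation.
Variable A : comNzRingType.

Definition at_pt (c : A) : {rmorphism {poly A} -> A} := horner_eval c.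

Definition dil (d : A) : {rmorphism {poly A} -> {poly A}} := comp_poly (d *: 'X).

Lemma dilC d c : dil d c%:P = c%:P.
Proof. exact: comp_polyC. Qed.

Lemma dilX d : dil d 'X = d *: 'X.
Proof. exact: comp_polyX. Qed.

Lemma coef_dil d p i : (dil d p)`_i = d ^+ i * p`_i.
Proof.
rewrite [LHS]/= comp_polyE coef_sum.
under eq_bigr => j _ do rewrite exprZn scalerA coefZ coefXn.
have [ip|ip] := ltnP i (size p).
  rewrite (bigD1 (Ordinal ip)) //= eqxx mulr1 mulrC big1 ?addr0 // => j ji.
  by rewrite eq_sym -[_ == i]/(val j == val (Ordinal ip)) val_eqE (negbTE ji) mulr0.
rewrite big1 ?[p`_i]nth_default ?mulr0 // => j _.
by rewrite eqn_leq leqNgt (leq_trans (ltn_ord j) ip) ?mulr0 ?andbF //=; case: leqP.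
Qed.

Lemma dilM d e p : dil d (dil e p) = dil (d * e) p.
Proof. by apply/polyP => i; rewrite !coef_dil exprMn mulrA. Qed.

Lemma at_ptC c a : at_pt c a%:P = a.
Proof. exact: hornerC. Qed.

Lemma at_ptX c : at_pt c 'X = c.
Proof. exact: hornerX. Qed.

Lemma at_pt_dil d c p : at_pt c (dil d p) = at_pt (d * c) p.
Proof. by rewrite /at_pt /= /horner_eval /= horner_comp hornerZ hornerX. Qed.

Lemma at_pt0_factor p : at_pt 0 p = 0 -> exists q, p = 'X * q.
Proof. by move/eqP/factor_theorem => [q ->]; exists q; rewrite subr0 mulrC. Qed.

End Dilation.

Section ExtendMorphism.
Variables (R K : comNzRingType) (h : {rmorphism R -> K}).

Definition poly_ext : {rmorphism {poly R} -> {poly K}} := map_poly h.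

Lemma poly_extC c : poly_ext c%:P = (h c)%:P.
Proof. exact: map_polyC. Qed.

Lemma poly_extX : poly_ext 'X = 'X.
Proof. exact: map_polyX. Qed.

Lemma coef_poly_ext p i : (poly_ext p)`_i = h p`_i.
Proof. exact: coef_map. Qed.

Lemma poly_ext_dil d p : poly_ext (dil d p) = dil (h d) (poly_ext p).
Proof.
by apply/polyP => i; rewrite coef_poly_ext !coef_dil coef_poly_ext rmorphM rmorphXn.
Qed.

End ExtendMorphism.

Opaque dil at_pt poly_ext.

(** A polynomial has finitely many coefficients, so a common denominator from D serves as a
    constant. Iterating this adjoins further indeterminates. *)
Lemma fractions_poly (R K : comNzRingType) (h : {rmorphism R -> K}) (D : R -> Prop) :
  fractions h D ->
  fractions (poly_ext h) (fun p => exists2 d, D d & p = d%:P).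
Proof.
move=> fr; split.
- by exists 1 => //; apply: frac1 fr.
- move=> _ _ [a Da ->] [b Db ->]; exists (a * b); first exact: (fracM fr).
  by rewrite rmorphM.
- move=> p hp; have [|d Dd dP] := @frac_kill_seq R K h D fr p.
    move=> a /(nthP 0)[i _ <-]; have := congr1 (fun q : {poly K} => q`_i) hp.
    by rewrite coef_poly_ext coef0.
  exists d%:P; first by exists d.
  apply/polyP => i; rewrite coefCM coef0.
  have [ip|ip] := ltnP i (size p); first exact/dP/mem_nth.
  by rewrite nth_default ?mulr0.
move=> k; have [d Dd dP] := @frac_clear_seq R K h D fr k.
exists d%:P; first by exists d.
have {}dP i : exists a, h d * k`_i = h a.
  have [ik|ik] := ltnP i (size k); first exact/dP/mem_nth.
  by exists 0; rewrite nth_default // mulr0 rmorph0.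
have [F FP] := choice dP; exists (\poly_(i < size k) F i).
apply/polyP => i; rewrite poly_extC coefCM coef_poly_ext coef_poly.
by case: ltnP => ik; [rewrite FP | rewrite nth_default // mulr0 rmorph0].
Qed.

Lemma pm_dilM (A : comNzRingType) n (d e : A) (phi : polymap {poly A} n) :
  pm_map (dil d) (pm_map (dil e) phi) = pm_map (dil (d * e)) phi.
Proof. by rewrite pm_mapM; apply: eq_pm_map => p; apply: dilM. Qed.

(** Used with [lB] the dilation of X by b: the factor b that appears on X is the one that clears the
    denominators of w. *)
Lemma map_mpoly_square (P B : comNzRingType) (H : {rmorphism P -> B})
    (l : {rmorphism P -> P}) (lB : {rmorphism B -> B}) x X b n (w1 : {mpoly P[n]}) w :
    (forall p, H (l p) = lB (H p)) -> H x = X -> lB X = X * lB b ->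
    map_mpoly H w1 = b *: w ->
  map_mpoly H (x *: map_mpoly l w1) = map_mpoly lB (X *: w).
Proof.
move=> Hl Hx lX Hw; apply/mpolyP => m.
rewrite !mcoeff_map !mcoeffZ mcoeff_map !rmorphM Hl Hx lX -(mcoeff_map H) Hw.
by rewrite mcoeffZ rmorphM mulrA.
Qed.

(** * Descent of small elementary products from K[X] to R[X] *)

Section Descent.
Variables (R K : comNzRingType) (h : {rmorphism R -> K}) (D : R -> Prop).
Hypothesis frK : fractions h D.

Local Notation H := (poly_ext h).
Local Notation ev0 := (at_pt (0 : R)).
Let frH := fractions_poly frK.

Lemma pm_dil_map n d (phi : polymap {poly R} n) :
  pm_map H (pm_map (dil d) phi) = pm_map (dil (h d)) (pm_map H phi).
Proof. by rewrite !pm_mapM; apply: eq_pm_map => p; apply: poly_ext_dil. Qed.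

Lemma pm_dil_ev0 n d (phi : polymap {poly R} n) :
  pm_map ev0 (pm_map (dil d) phi) = pm_map ev0 phi.
Proof.
rewrite pm_mapM; apply: eq_pm_map => p.
by rewrite -[RHS](congr1 (fun c => at_pt c p) (mulr0 d)); apply: at_pt_dil.
Qed.

Lemma lift_small_elementary n (g : polymap {poly K} n) : small_elementary 'X g ->
  exists2 d, D d & exists v, [/\ elementary v,
    pm_map H v = pm_map (dil (h d)) g & pm_map ev0 v = pm_id].
Proof.
move=> [i [f [fi sf ->]]]; have [w wi ->] := smul_free fi sf.
have [_ [d Dd ->] [w0 hw0]] := frac_clear_mpoly frH w.
(* h need not be injective, so [w0] may involve X_i. Setting X_i to 0 keeps its image, since w is
   free of X_i. *)
exists d => //; pose w1 := w0 \mPo zero_at _ i.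
have hw1 : map_mpoly H w1 = H d%:P *: w.
  rewrite map_mpoly_comp -hw0.
  rewrite (_ : [tuple _ | _ < n] = zero_at _ i) ?comp_mpolyZ ?zero_at_id //.
  apply: eq_from_tnth => j; rewrite !tnth_mktuple.
  by case: ifP => _; rewrite ?rmorph0 ?map_mpolyXi.
pose G := 'X *: map_mpoly (dil d) w1.
exists (elem_map i G); split.
- exists i, G; split=> //; apply/free_ofZ/free_of_map; exact: zero_at_free.
- rewrite !pm_map_elem; congr elem_map.
  apply: (map_mpoly_square (l := dil d) (poly_ext_dil h d) (poly_extX h) _ hw1).
  by rewrite poly_extC dilC dilX -mul_polyC mulrC.
by rewrite pm_map_elem /G map_mpolyZ at_ptX scale0r elem_map0.
Qed.

Lemma lift_small_EA n (g : polymap {poly K} n) : small_EA 'X g ->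
  exists2 d, D d & exists v, [/\ EA v,
    pm_map H v = pm_map (dil (h d)) g & pm_map ev0 v = pm_id].
Proof.
elim=> [|{}g w /lift_small_elementary[d Dd [v [vE Hv v0]]] _ [e De [u [uE Hu u0]]]].
  exists 1; first exact: frac1 frK.
  by exists pm_id; rewrite !pm_map1; split=> //; apply: gen_id.
exists (d * e); first exact: (fracM frK Dd De).
(* Each lift is dilated by the denominator of the other, so that both lie over the same dilation. *)
exists (pm_comp (pm_map (dil e) v) (pm_map (dil d) u)); split.
- apply/words_elementary_EA/words_cons; first exact: pm_map_elementary.
  move/words_elementary_EA: uE; apply: pm_map_words => x; exact: pm_map_elementary.
- have Hv' : pm_map H (pm_map (dil e) v) = pm_map (dil (h (d * e))) g.
    by rewrite pm_dil_map Hv pm_dilM -rmorphM mulrC.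
  have Hu' : pm_map H (pm_map (dil d) u) = pm_map (dil (h (d * e))) w.
    by rewrite pm_dil_map Hu pm_dilM -rmorphM.
  exact: etrans (pm_map_comp H _ _) (etrans (f_equal2 _ Hv' Hu') (esym (pm_map_comp _ g w))).
have v0' := etrans (pm_dil_ev0 e v) v0; have u0' := etrans (pm_dil_ev0 d u) u0.
exact: etrans (pm_map_comp ev0 _ _) (etrans (f_equal2 _ v0' u0') (pm_comp1p _)).
Qed.

(** A dilation leaves constant terms in X alone, hence the condition at X = 0. It gives f = X V with
    V zero over K[X], so d V = 0 for some d in D, and the dilation by d turns the factor X into d X,
    which then kills the image of V. *)
Lemma dil_kill n (f : {mpoly {poly R}[n]}) :
  map_mpoly ev0 f = 0 -> map_mpoly H f = 0 ->
  exists2 d, D d & map_mpoly (dil d) f = 0.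
Proof.
move=> f0 Hf; have [||V VP] := @mpoly_choose {poly R} {poly R} n f (fun a b => a = 'X * b).
- by rewrite mulr0.
- by move=> m; apply: at_pt0_factor; rewrite -(mcoeff_map ev0) f0 mcoeff0.
have HV : map_mpoly H V = 0.
  apply/mpolyP => m; rewrite mcoeff0 mcoeff_map; apply/polyP => i.
  have := congr1 (fun q : {mpoly {poly K}[n]} => q@_m`_i.+1) Hf.
  by rewrite mcoeff_map VP rmorphM poly_extX mcoeff0 coefXM !coef0.
have [_ [d Dd ->] dV] := frac_kill_mpoly frH HV.
exists d => //; apply/mpolyP => m; rewrite mcoeff_map mcoeff0 VP rmorphM dilX.
have := congr1 (fun q : {mpoly {poly R}[n]} => dil d q@_m) dV.
rewrite mcoeffZ rmorphM dilC mcoeff0 rmorph0 => e.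
by rewrite -mul_polyC mulrAC e mul0r.
Qed.

Lemma unique_lift n (phi psi : polymap {poly R} n) :
    pm_map ev0 phi = pm_id -> pm_map ev0 psi = pm_id -> pm_map H phi = pm_map H psi ->
  exists2 d, D d & pm_map (dil d) phi = pm_map (dil d) psi.
Proof.
move=> phi0 psi0 Hpp.
suff: exists2 d, D d & forall i, i \in enum 'I_n ->
    map_mpoly (dil d) (tnth phi i) = map_mpoly (dil d) (tnth psi i).
  case=> d Dd dP; exists d; first exact: Dd.
  apply: eq_from_tnth => i.
  by rewrite !tnth_pm_map dP ?mem_enum.
elim: (enum 'I_n) => [|i r [d Dd dP]]; first by exists 1; first exact: (frac1 frK).
have [||e De eP] := @dil_kill n (tnth phi i - tnth psi i).
- by rewrite rmorphB /= -!tnth_pm_map phi0 psi0 subrr.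
- by rewrite rmorphB /= -!tnth_pm_map Hpp subrr.
have dilMm a b (f : {mpoly {poly R}[n]}) :
    map_mpoly (dil (a * b)) f = map_mpoly (dil a) (map_mpoly (dil b) f).
  by apply/mpolyP => m; rewrite !mcoeff_map dilM.
exists (e * d); first exact: (fracM frK De Dd).
move=> j; rewrite inE => /orP[/eqP->|/dP dj]; last by rewrite !dilMm dj.
move/eqP: eP; rewrite rmorphB subr_eq0 mulrC => /eqP eP.
by rewrite !dilMm eP.
Qed.

(** A first dilation lifts the factorization from K[X] to R[X]; a second one makes the lift agree
    with rho. *)
Theorem descent n (rho : polymap {poly R} n) :
    pm_map ev0 rho = pm_id -> stably_small_EA 'X (pm_map H rho) ->
  exists2 d, D d & stably_tame (pm_map (dil d) rho).
Proof.
move=> rho0 [N nN] sN; have [d Dd [v [vEA Hv v0]]] := lift_small_EA sN.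
rewrite -pm_map_stab -pm_dil_map in Hv.
have rho0N : pm_map ev0 (pm_map (dil d) (stab N rho)) = pm_id.
  by rewrite pm_dil_ev0 pm_map_stab rho0 stab1.
have [e De eP] := unique_lift v0 rho0N Hv.
exists (e * d); first exact: (fracM frK De Dd).
apply/stably_tameP; exists N; first exact: nN.
rewrite -pm_map_stab -[pm_map _ _](pm_dilM e d) -eP.
by apply/pm_map_TA/gen_base; right.
Qed.

End Descent.

(** * Existence of prime ideals *)

Section PrimeIdeal.
Variable R : comNzRingType.

Record proper_ideal_set (S : set R) : Prop := ProperIdealSet {
  pis0 : S 0;
  pis1 : ~ S 1;
  pisMD : forall a x y, S x -> S y -> S (a * x + y) }.

Lemma maximal_ideal (J : set R) : proper_ideal_set J ->
  exists M : set R, [/\ proper_ideal_set M, (J `<=` M)%classic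
    & forall u, ~ M u -> exists r m, M m /\ 1 = r * u + m].
Proof.
(* Zorn's lemma is applied to all chains, the empty one included; adjoining J makes the condition
   hold for its empty union. *)
move=> idJ; pose P (A : set R) := proper_ideal_set (A `|` J)%classic.
have [F FP Ftot|A [idA maxA]] := @Zorn_bigcup R P.
  split; first by right; apply: pis0.
    by case=> [[X FX X1]|]; [apply: (pis1 (FP X FX)); left | apply: pis1].
  move=> a x y [[X FX Xx]|Jx] [[Y FY Yy]|Jy].
  - have [XY|YX] := Ftot X Y FX FY.
      by case: (pisMD (FP Y FY) a (or_introl (XY _ Xx)) (or_introl Yy)); [left; exists Y | right].
    by case: (pisMD (FP X FX) a (or_introl Xx) (or_introl (YX _ Yy))); [left; exists X | right].
  - by case: (pisMD (FP X FX) a (or_introl Xx) (or_intror Jy)); [left; exists X | right].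
  - by case: (pisMD (FP Y FY) a (or_intror Jx) (or_introl Yy)); [left; exists Y | right].
  by right; apply: pisMD.
exists (A `|` J)%classic; split=> // u Mu.
(* B is the ideal generated by u and the maximal one; if it misses 1, it contradicts maximality. *)
apply: contrapT => no1; pose B : set R := fun x => exists r m, (A `|` J)%classic m /\ x = r * u + m.
have MB x : (A `|` J)%classic x -> B x by exists 0, x; rewrite mul0r add0r.
have MD x y : (A `|` J)%classic x -> (A `|` J)%classic y -> (A `|` J)%classic (x + y).
  by move=> Mx My; rewrite -[x]mul1r; apply: pisMD.
have Bu : B u by exists 1, 0; rewrite mul1r addr0; split=> //; apply: pis0 idA.
apply: (maxA B).
  split; last by move=> BA; apply: Mu; left; apply: BA.
  by move=> x Ax; apply: MB; left.
have BJ x : (B `|` J)%classic x -> B x by case=> // Jx; apply: MB; right.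
split; first by left; apply: MB; apply: pis0 idA.
  by move=> /BJ[r [m [Mm e]]]; apply: no1; exists r, m.
move=> a x y /BJ[r [m [Mm ->]]] /BJ[r' [m' [Mm' ->]]].
left; exists (a * r + r'), (a * m + m'); split; last by ring.
exact: pisMD.
Qed.

Lemma prime_ideal_above (J : set R) : proper_ideal_set J ->
  exists p : prime_idealr R, forall x, J x -> x \in (p : pred R).
Proof.
move=> /maximal_ideal[M [idM JM maxM]].
pose S : pred R := fun x => `[<M x>].
have S_ideal : idealr_closed S.
  split; first exact/asboolP/(pis0 idM).
    by apply/asboolP/(pis1 idM).
  by move=> a x y /asboolP Mx /asboolP My; apply/asboolP; apply: (pisMD idM).
have S_prime : prime_idealr_closed S.
  move=> u v /asboolP Muv; apply/orP.
  have [Mu|Mu] := pselect (M u); [by left; apply/asboolP | right; apply/asboolP].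
  have [r [m [Mm e1]]] := maxM u Mu.
  have -> : v = r * (u * v) + (v * m + 0) by rewrite -[LHS]mul1r e1; ring.
  exact: (pisMD idM _ Muv (pisMD idM _ Mm (pis0 idM))).
pose p : prime_idealr R := HB.pack S (isIdealr.Build R S S_ideal)
  (isPrimeIdealrClosed.Build R S S_prime).
by exists p => x Jx; apply/asboolP/JM.
Qed.

End PrimeIdeal.

Lemma fractions_toloc (R : comNzRingType) (p : prime_idealr R) :
  fractions (Localization.toloc p : {rmorphism R -> localization p})
    (fun d => d \notin (p : pred R)).
Proof.
split.
- exact: Localization.notin1.
- exact: Localization.notinM.
- move=> a; rewrite -[X in _ = X](rmorph0 (Localization.toloc p)).
  by move/toloc_eqP => [u up]; rewrite subr0; exists u.
move=> x; have [a [s [sp e]]] := toloc_surj x.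
by exists s => //; exists a; rewrite mulrC.
Qed.

(** * Jumps between difference quotients *)

Lemma stably_tame_map (R S : comNzRingType) (h : {rmorphism R -> S}) n (phi : polymap R n) :
  stably_tame phi -> stably_tame (pm_map h phi).
Proof.
move=> /stably_tameP[N nN t]; apply/stably_tameP; exists N => //.
by rewrite -pm_map_stab; apply: pm_map_TA.
Qed.

Definition poly_const (A : comNzRingType) : {rmorphism A -> {poly A}} := polyC.

Opaque poly_const.

Section Jump.
Variables (R : comNzRingType) (n : nat).
Implicit Types (phi psi : polymap R n).

(* When [psi] is the inverse of [phi], this is phi_t^-1 o phi_t', where
   phi_t (X) = (phi (t X) - phi (0)) / t. *)
Definition jump phi psi t t' : polymap R n :=
  pm_comp (pm_dquot (pm_eval phi (fun=> 0)) t psi) (pm_dquot (fun=> 0) t' phi).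

Lemma jump_id phi psi t : pm_inverse phi psi -> jump phi psi t t = pm_id.
Proof. by move=> /(pm_dquot_inverse (fun=> 0) t)[_]. Qed.

Lemma jump_comp phi psi t t' t'' : pm_inverse phi psi ->
  pm_comp (jump phi psi t t') (jump phi psi t' t'') = jump phi psi t t''.
Proof.
move=> /(pm_dquot_inverse (fun=> 0) t')[e _].
by rewrite /jump pm_compA -(pm_compA (pm_dquot _ t' phi)) e pm_comp1p.
Qed.

Lemma pm_dquot_jump phi psi t t' : pm_inverse phi psi ->
  pm_comp (pm_dquot (fun=> 0) t phi) (jump phi psi t t') = pm_dquot (fun=> 0) t' phi.
Proof. by move=> /(pm_dquot_inverse (fun=> 0) t)[e _]; rewrite -pm_compA e pm_comp1p. Qed.

End Jump.

Lemma map_jump (R S : comNzRingType) (h : {rmorphism R -> S}) n (phi psi : polymap R n) t t' :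
  pm_map h (jump phi psi t t') = jump (pm_map h phi) (pm_map h psi) (h t) (h t').
Proof.
have h0 : h \o (fun=> 0) = (fun=> 0) :> ('I_n -> S) by apply: funext => i; apply: rmorph0.
by rewrite /jump pm_map_comp !map_pm_dquot map_pm_eval h0.
Qed.

Opaque jump.

(** With C1 and C2 adjoining indeterminates and f and g evaluations, stable tameness of a jump at
    generic parameters passes to parameters in R. *)
Lemma jump_specialize (R A B : comNzRingType) (C1 : {rmorphism R -> A})
    (C2 : {rmorphism A -> B}) (f : {rmorphism A -> R}) (g : {rmorphism B -> A}) n
    (phi psi : polymap R n) a b :
    (forall x, f (C1 x) = x) -> (forall x, g (C2 x) = x) ->
  stably_tame (jump (pm_map C2 (pm_map C1 phi)) (pm_map C2 (pm_map C1 psi)) a b) ->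
  stably_tame (jump phi psi (f (g a)) (f (g b))).
Proof.
move=> fC gC /(stably_tame_map g)/(stably_tame_map f); rewrite !map_jump.
have fgC (chi : polymap R n) : pm_map f (pm_map g (pm_map C2 (pm_map C1 chi))) = chi.
  have fgCid : f \o (g \o (C2 \o C1)) =1 id by move=> x /=; rewrite gC fC.
  by rewrite !pm_mapM pm_map_id.
by rewrite (fgC phi) (fgC psi).
Qed.

Lemma jump_locally_tame (R K : comNzRingType) (h : {rmorphism R -> K}) (D : R -> Prop) n
    (phi psi : polymap R n) t z :
    fractions h D -> pm_inverse phi psi -> TA (pm_map h phi) ->
  exists2 d, D d & exists k, stably_tame (jump phi psi t (t + d ^+ k * (d * z))).
Proof.
move=> fr phiK tphi.
pose C := poly_const R; pose H := poly_ext h.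
have tC : TA (pm_map H (pm_map C phi)).
  rewrite pm_mapM (_ : pm_map _ phi = pm_map (poly_const K) (pm_map h phi)).
    exact: pm_map_TA.
  by rewrite pm_mapM; apply: eq_pm_map => a; apply: poly_extC.
have CK : pm_inverse (pm_map H (pm_map C phi)) (pm_map H (pm_map C psi)).
  by do 2!apply: pm_map_inverse.
have [k kP] := TA_dquot_step 'X tC (pm_dquot_inverse (fun=> 0) (H (C t)) CK).
have {}kP u : stably_small_EA 'X (jump (pm_map H (pm_map C phi)) (pm_map H (pm_map C psi))
    (H (C t)) (H (C t) + 'X ^+ k * u)) by exact: kP.
(* The extra factor 'X makes rho the identity at 'X = 0 even when k = 0, as [descent] requires. *)
pose rho := jump (pm_map C phi) (pm_map C psi) (C t) (C t + 'X ^+ k * ('X * C z)).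
have Hrho : stably_small_EA 'X (pm_map H rho).
  rewrite map_jump (_ : H (C t + _) = H (C t) + 'X ^+ k * ('X * H (C z))); first exact: kP.
  by rewrite rmorphD !rmorphM rmorphXn poly_extX.
have atC c (chi : polymap R n) : pm_map (at_pt c) (pm_map C chi) = chi.
  by rewrite pm_mapM; apply: pm_map_id => a; apply: at_ptC.
have at_rho c : pm_map (at_pt c) rho = jump phi psi t (t + c ^+ k * (c * z)).
  rewrite map_jump !atC; congr jump; first exact: at_ptC.
  by rewrite rmorphD !rmorphM rmorphXn at_ptX !at_ptC.
have [|d Dd dP] := descent fr _ Hrho.
  by rewrite at_rho mul0r mulr0 addr0 jump_id.
exists d => //; exists k.
rewrite -at_rho.
have <- : pm_map (at_pt 1) (pm_map (dil d) rho) = pm_map (at_pt d) rho.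
  rewrite pm_mapM; apply: eq_pm_map => q; rewrite -[in RHS](mulr1 d); exact: at_pt_dil.
exact: stably_tame_map.
Qed.

(** The denominator given by [jump_locally_tame] depends on the two parameters. Taking them to be
    indeterminates yields one d for all t and u. *)
Lemma jump_tame_at (R : comNzRingType) n (phi psi : polymap R n) (p : prime_idealr R) :
    pm_inverse phi psi -> TA (pm_at p phi) ->
  exists2 d, d \notin (p : pred R) & forall t u, stably_tame (jump phi psi t (t + d * u)).
Proof.
move=> phiK tphi.
pose C1 := poly_const R; pose C2 := poly_const {poly R}.
have fr := fractions_poly (fractions_poly (fractions_toloc p)).
have CK : pm_inverse (pm_map C2 (pm_map C1 phi)) (pm_map C2 (pm_map C1 psi)).
  by do 2!apply: pm_map_inverse.
(* The outer indeterminate is the generic t and the inner one, [C2 'X], the generic u. The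
   denominator is constant in both, hence comes from R. *)
have [|_ [_ [d dp ->] ->] [k tk]] := jump_locally_tame 'X (C2 'X) fr CK.
  rewrite !pm_mapM (_ : pm_map _ phi = pm_map (poly_const _) (pm_map (poly_const _) (pm_at p phi))).
    by do 2!apply: pm_map_TA.
  rewrite !pm_mapM; apply: eq_pm_map => a.
  exact: etrans (poly_extC (poly_ext _) a%:P) (congr1 polyC (poly_extC _ a)).
exists (d ^+ k * d).
  rewrite -exprSr; elim: k {tk} => [|k IH]; first by rewrite expr1.
  by rewrite exprS; apply: Localization.notinM.
move=> t u.
have := jump_specialize (at_ptC u) (at_ptC (C1 t)) tk.
rewrite at_ptX at_ptC.
suff -> : at_pt u (at_pt (C1 t) ('X + d%:P%:P ^+ k * (d%:P%:P * C2 'X))) = t + d ^+ k * d * u by [].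
by rewrite !(rmorphD, rmorphM, rmorphXn) /= !at_ptC !at_ptX !at_ptC mulrA.
Qed.

(** * From jumps back to phi *)

Lemma small_EA_TA (R : comNzRingType) n (s : R) (phi : polymap R n) : small_EA s phi -> TA phi.
Proof.
move=> sphi; apply/TA_words; apply: words_sub sphi => _ [i [f [fi _ ->]]].
by apply: words_base; right; exists i, f.
Qed.

Lemma TA_translation (R : comNzRingType) n (c : 'I_n -> R) :
  TA ([tuple 'X_i + (c i)%:MP | i < n] : polymap R n).
Proof.
(* With s = 1 smallness is no condition, and constants involve no variable. *)
apply: (@small_EA_TA _ _ 1).
rewrite (_ : [tuple _ | _ < n] =
    [tuple if i \in enum 'I_n then 'X_i + (c i)%:MP else 'X_i | i < n]).
  apply: small_EA_multi => [|i j _ _|j _]; first exact: enum_uniq.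
    exact: free_ofC.
  by exists (c j)%:MP; rewrite scale1r.
by apply: eq_from_tnth => i; rewrite !tnth_mktuple mem_enum.
Qed.

Lemma pm_dquot_at1 (R : comNzRingType) n (phi : polymap R n) :
  phi = pm_comp [tuple 'X_i + (pm_eval phi (fun=> 0) i)%:MP | i < n]
                (pm_dquot (fun=> 0) 1 phi).
Proof.
apply: eq_from_tnth => i; rewrite tnth_pm_comp tnth_mktuple.
rewrite comp_mpolyD comp_mpolyXi comp_mpolyC tnth_pm_dquot.
rewrite -[dquot _ _ _]scale1r scale_dquot (_ : scaling _ _ = pm_id).
  by rewrite comp_mpoly_id subrK.
by apply: eq_from_tnth => j; rewrite tnth_pm_id tnth_mktuple scale1r raddf0 addr0.
Qed.

Theorem theorem4p14 (R : comNzRingType) (n : nat) (phi : polymap R n) :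
  GA phi -> locally_tame phi -> stably_tame phi.
Proof.
move=> [psi phiK] tphi.
pose J (r : R) := forall t u, stably_tame (jump phi psi t (t + r * u)).
have J0 : J 0 by move=> t u; rewrite mul0r addr0 jump_id //; apply/TA_stably_tame/gen_id.
have JMD a x y : J x -> J y -> J (a * x + y).
  (* The jump by (a x + y) u is a jump by y u composed with one by x (a u) from the new starting
     point t + y u; hence the quantification over t in J. *)
  move=> Jx Jy t u; rewrite -(jump_comp t (t + y * u) _ phiK).
  apply: stably_tame_comp (Jy t u) _.
  rewrite (_ : t + (a * x + y) * u = t + y * u + x * (a * u)); last by ring.
  exact: Jx.
(* Otherwise J lies in a prime p, while tameness at p puts an element of J outside p. *)
have J1 : J 1.
  apply: contrapT => nJ1.
  have [p pJ] := prime_ideal_above (ProperIdealSet J0 nJ1 JMD).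
  have [d dp Jd] := jump_tame_at phiK (tphi p).
  by move: dp; rewrite pJ.
have [A phi0] := pm_dquot_at0 (fun=> 0) phi.
have phi0K := pm_dquot_inverse (fun=> 0) 0 phiK.
(* The inverse of phi_0 is a difference quotient of psi at parameter 0, hence linear as well, so the
   matrix of phi_0 is invertible. *)
have phi0_GL : GL (pm_dquot (fun=> 0) 0 phi).
  rewrite phi0 in phi0K *; have [B psi0] := pm_dquot_at0 (pm_eval phi (fun=> 0)) psi.
  by rewrite psi0 in phi0K; apply: lin_map_GL phi0K.
(* phi is the composite of a translation, phi_0 and the jump from 0 to 1. *)
rewrite (pm_dquot_at1 phi); apply: stably_tame_comp; first exact/TA_stably_tame/TA_translation.
rewrite -(pm_dquot_jump 0 1 phiK); apply: stably_tame_comp; last first.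
  by have := J1 0 1; rewrite add0r mulr1.
by apply/TA_stably_tame/gen_base; left.
Qed.
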